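(* Suppose that (QSA1) holds and $a_t=(1+t)^{-\rho}$ with $\rho\in(0,1)$, and let $\{\Theta_t\}$ be the solution of the QSA ODE $\frac{d}{dt}\Theta_t=a_t f(\Theta_t,\xi_t)$. (i) If (QSA5) holds, then the perturbative mean flow representation $$\frac{d}{dt}\Theta_t=a_t\big[\bar f(\Theta_t)-a_t\,\bar\Upsilon(\Theta_t)+\mathcal W_t\big],\qquad \mathcal W_t=\sum_{i=0}^{2}a_t^{2-i}\frac{d^i}{dt^i}\mathcal W^i_t ,$$ holds with $\mathcal W^i_t=\mathcal W^i(\Theta_t,\Phi_t)$, where $$\mathcal W^0(\Theta_t,\Phi_t)=-[\mathcal D^f\hat\Upsilon](\Theta_t,\Phi_t)+\frac{r_t}{a_t}[\mathcal D^f\hat{\hat f}\,](\Theta_t,\Phi_t),$$ $$\mathcal W^1(\Theta_t,\Phi_t)=-[\mathcal D^f\hat{\hat f}\,](\Theta_t,\Phi_t)+\hat\Upsilon(\Theta_t,\Phi_t),\qquad \mathcal W^2(\Theta_t,\Phi_t)=\hat{\hat f}(\Theta_t,\Phi_t),$$ and $r_t=\rho/(t+1)$. (ii) If (QSA0) and (QSA5) hold, then $\bar\Upsilon(\theta)=0$ for each $\theta\in\mathbb R^d$. (iii) If (QSA2) and (QSA3) hold, then $\{\Theta_t\}$ is ultimately bounded: there exists $b<\infty$ such that for any $\Theta_0$, $\limsup_{t\to\infty}\|\Theta_t\|\le b$.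
   Context: Setup. Let $d,m,K\ge1$ be integers and $j=\sqrt{-1}$. The probing signal is $\xi_t=G_0(\xi^0_t)\in\mathbb R^m$, $\xi^0_t=(\cos(2\pi[\omega_1t+\phi_1]),\dots,\cos(2\pi[\omega_Kt+\phi_K]))^{\top}$, with distinct frequencies $\omega_i$, arbitrary phases $\phi_i$, and $G_0:\mathbb R^K\to\mathbb R^m$ analytic on $\mathbb C^K$. Put $\Phi_t=(\exp(2\pi j[\omega_it+\phi_i]))_{i=1}^K$, which evolves on $\Omega=\{z\in\mathbb C^K:|z_i|=1,\ 1\le i\le K\}$ and satisfies $\frac{d}{dt}\Phi_t=W\Phi_t$, $W=2\pi j\,\mathrm{diag}(\omega_i)$. With $G(z)=G_0(\tfrac12(z+z^{-1}))$ (entrywise inverse), $\xi_t=G(\Phi_t)$. Let $\pi$ be the uniform distribution on $\Omega$. The function $f:\mathbb R^d\times\mathbb R^m\to\mathbb R^d$ is given, $\{a_t\}$ is the gain process, and $\bar f(\theta)=\lim_{T\to\infty}\frac1T\int_0^Tf(\theta,\xi_t)\,dt=\int_\Omega f(\theta,G(z))\,\pi(dz)$. For a $C^1$ function $g$ on $\mathbb R^d\times\Omega$, $[\mathcal D^fg](\theta,z)=\partial_\theta g(\theta,z)\cdot f(\theta,G(z))$ (entrywise for vector-valued $g$). (QSA0) (a) $\xi_t=G_0(\xi^0_t)$ for all $t$, with $G_0$ analytic and the coefficients in the Taylor series expansion of $G_0(\xi^0_t)$ absolutely summable. (b) $\omega_i=\log(a_i/b_i)>0$ for $1\le i\le K$,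 with $a_i,b_i$ positive integers, and $\{\omega_i\}$ linearly independent over the rationals. (QSA1) $\{a_t\}$ is non-negative, monotonically decreasing, $\lim_{t\to\infty}a_t=0$ and $\int_0^\infty a_r\,dr=\infty$. (QSA2) There is $L_f<\infty$ with $\|\bar f(\theta')-\bar f(\theta)\|\le L_f\|\theta'-\theta\|$ and $\|f(\theta',\xi)-f(\theta,\xi)\|+\|f(\theta,\xi')-f(\theta,\xi)\|\le L_f[\|\theta'-\theta\|+\|\xi'-\xi\|]$ for all $\theta,\theta'\in\mathbb R^d$, $\xi,\xi'\in\mathbb R^m$. (QSA3) The ODE $\frac{d}{dt}\vartheta_t=\bar f(\vartheta_t)$ is globally asymptotically stable with unique equilibrium $\theta^*$, and one of the following holds: (a) there is a Lipschitz continuous Lyapunov function $V:\mathbb R^d\to\mathbb R_+$, a constant $\delta_0>0$ and a compact set $S$ such that $\nabla V(\vartheta_t)\cdot\bar f(\vartheta_t)\le-\delta_0\|\vartheta_t\|$ whenever $\vartheta_t\notin S$; or (b) $\bar f_\infty(\theta)=\lim_{c\to\infty}\bar f(c\theta)/c$ exists for all $\theta$ as a continuous function, and the ODE $\frac{d}{dt}x_t=\bar f_\infty(x_t)$ is globally asymptotically stable. (QSA5) For each initial condition $\Phi_0\in\Omega$ the time averages of the functions below exist and equal their $\pi$-averages, and for each $\theta$: (i) there is $\hat f(\theta,\cdot)$ with $\hat f(\theta,\Phi_{t_0})=\int_{t_0}^{t_1}[f(\theta,\xi_t)-\bar f(\theta)]\,dt+\hat f(\theta,\Phi_{t_1})$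 for $0\le t_0\le t_1$ and $\int_\Omega\hat f(\theta,z)\,\pi(dz)=0$; $\hat f$ is $C^1$ on $\mathbb R^d\times\Omega$; and $\hat A=\partial_\theta\hat f$ satisfies $\int_\Omega\hat A(\theta,z)\,\pi(dz)=0$. (ii) With $\Upsilon(\theta,z)=-\hat A(\theta,z)f(\theta,G(z))$ and $\bar\Upsilon(\theta)=\lim_{T\to\infty}\frac1T\int_0^T\Upsilon(\theta,\Phi_t)\,dt=\int_\Omega\Upsilon(\theta,z)\,\pi(dz)$, there are $C^1$ functions $\hat{\hat f},\hat\Upsilon$ on $\mathbb R^d\times\Omega$ with $\hat{\hat f}(\theta,\Phi_{t_0})=\int_{t_0}^{t_1}\hat f(\theta,\Phi_t)\,dt+\hat{\hat f}(\theta,\Phi_{t_1})$ and $\hat\Upsilon(\theta,\Phi_{t_0})=\int_{t_0}^{t_1}[\Upsilon(\theta,\Phi_t)-\bar\Upsilon(\theta)]\,dt+\hat\Upsilon(\theta,\Phi_{t_1})$ for $0\le t_0\le t_1$, and $\int_\Omega\hat{\hat f}(\theta,z)\,\pi(dz)=\int_\Omega\hat\Upsilon(\theta,z)\,\pi(dz)=0$. Moreover $\hat f$ and $\hat\Upsilon$ are Lipschitz continuous in $\theta$.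
   Formalization: f is assumed jointly continuous; in (i) the derivatives of W^1 and W^2 are taken in the sense of distributions on (0,∞), and the formula holds classically at each time where W^1 is differentiable, since under (QSA5) these derivatives need not exist. *)

(* Defs.v *)
From HB Require Import structures.
From mathcomp Require Import all_boot all_order all_algebra.
From mathcomp Require Import complex ring.
From mathcomp Require Import all_classical all_reals all_analysis.

Set Implicit Arguments.
Unset Strict Implicit.
Unset Printing Implicit Defensive.

Import Order.TTheory GRing.Theory Num.Theory.
Import numFieldNormedType.Exports.

Local Open Scope classical_set_scope.
Local Open Scope ring_scope.

(* Vectors of R^n are rows 'rV[R]_n and `|v| is the library's (sup) norm.  Every
   use of a norm below is insensitive to replacing it by an equivalent one, the
   constants involved being existentially quantified.
   Integrals over a time interval are Lebesgue integrals, entry by entry. *)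

Section Qsa.
Context {R : realType}.

Local Notation mu := (@lebesgue_measure R).

Definition vintegral n (D : set R) (u : R -> 'rV[R]_n) : 'rV[R]_n :=
  \row_i \int[mu]_(t in D) u t 0 i.

(* [circ x] is the point of C^K with coordinates exp (2 pi j x_i); it maps R^K
   onto Omega, and is a covering of Omega by R^K. *)
Definition circ K (x : 'rV[R]_K) : 'rV[R[i]]_K :=
  \row_i Complex (cos (2 * pi * x 0 i)) (sin (2 * pi * x 0 i)).

Definition Omega K : set 'rV[R[i]]_K := [set z | forall i, `|z 0 i| = 1].

Definition Phi K (omega phi : 'rV[R]_K) (t : R) : 'rV[R[i]]_K :=
  circ (phi + t *: omega).

Definition xi0 K (omega phi : 'rV[R]_K) (t : R) : 'rV[R]_K :=
  \row_i cos (2 * pi * (omega 0 i * t + phi 0 i)).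

Definition xi K m (G0 : 'rV[R]_K -> 'rV[R]_m) (omega phi : 'rV[R]_K) (t : R) :
  'rV[R]_m := G0 (xi0 omega phi t).

(* On Omega the numbers (z_i + z_i^-1) / 2 are real, so that taking their real
   part only changes their type. *)
Definition Gmap K m (G0 : 'rV[R]_K -> 'rV[R]_m) (z : 'rV[R[i]]_K) : 'rV[R]_m :=
  G0 (\row_i complex.Re (2^-1 * (z 0 i + (z 0 i)^-1))).

Lemma xiE K m (G0 : 'rV[R]_K -> 'rV[R]_m) (omega phi : 'rV[R]_K) (t : R) :
  xi G0 omega phi t = Gmap G0 (Phi omega phi t).
Proof.
congr (G0 _); apply/rowP => i; rewrite !mxE.
have -> : phi 0 i + t * omega 0 i = omega 0 i * t + phi 0 i.
  by rewrite addrC mulrC.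
set x := 2 * pi * _.
have -> : (Complex (cos x) (sin x))^-1 = Complex (cos x) (- sin x).
  by rewrite /GRing.inv /= cos2Dsin2 !divr1.
by simpc; rewrite /=; field.
Qed.

Definition monom K (x : 'rV[R]_K) (alpha : {ffun 'I_K -> nat}) : R :=
  \prod_i x 0 i ^+ alpha i.

(* The Taylor series of G0 at the origin, with coefficients c, converges
   absolutely on every polydisc {|z_i| <= r_i} of C^K, and its sum on R^K is G0.
   The partial sums run over the multi-indices with all entries < N. *)
Definition taylor_expansion K m (G0 : 'rV[R]_K -> 'rV[R]_m)
    (c : {ffun 'I_K -> nat} -> 'rV[R]_m) : Prop :=
  (forall r : 'rV[R]_K, (forall i, 0 <= r 0 i) ->
     (\esum_(alpha in setT) (`|c alpha| * monom r alpha)%:E < +oo)%E) /\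
  (forall x : 'rV[R]_K,
     (\sum_(beta : {ffun 'I_K -> 'I_N})
        let alpha := [ffun i => nat_of_ord (beta i)] in
        monom x alpha *: c alpha) @[N --> \oo] --> G0 x).

Definition analytic_on_CK K m (G0 : 'rV[R]_K -> 'rV[R]_m) : Prop :=
  exists c, taylor_expansion G0 c.

(* Integral over the unit cube [0,1]^n, as an iterated integral (all integrands
   of interest are continuous). *)
Fixpoint cube_integral (n : nat) : ('rV[R]_n -> R) -> R :=
  match n return ('rV[R]_n -> R) -> R with
  | 0%N => fun h => h 0
  | p.+1 => fun h =>
      \int[mu]_(x in `[0, 1])
        cube_integral (fun y : 'rV[R]_p => h (row_mx (x%:M : 'rV[R]_1) y))
  end.

(* The integral of g against the uniform distribution pi on Omega, that is the
   image by [circ] of Lebesgue measure on [0,1]^K. *)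
Definition pi_mean K p q (g : 'rV[R[i]]_K -> 'M[R]_(p, q)) : 'M[R]_(p, q) :=
  \matrix_(i, j) cube_integral (fun x => g (circ x) i j).

Definition time_average p q (u : R -> 'M[R]_(p, q)) (T : R) : 'M[R]_(p, q) :=
  \matrix_(i, j) (T^-1 * \int[mu]_(t in `[0, T]) u t i j).

(* As [circ] is onto Omega, every initial condition Phi_0 is met. *)
Definition ergodic K (omega : 'rV[R]_K) p q
    (g : 'rV[R[i]]_K -> 'M[R]_(p, q)) : Prop :=
  forall phi : 'rV[R]_K,
    time_average (fun t => g (Phi omega phi t)) T @[T --> +oo] --> pi_mean g.

Definition C1 (U V : normedModType R) (h : U -> V) : Prop :=
  (forall p, differentiable h p) /\
  (forall v, continuous (fun p => 'd h p v)).

(* C^1 on the manifold R^d x Omega: C^1 in the angular coordinates. *)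
Definition C1_torus d K n (g : 'rV[R]_d -> 'rV[R[i]]_K -> 'rV[R]_n) : Prop :=
  C1 (fun p : 'rV[R]_d * 'rV[R]_K => g p.1 (circ p.2)).

(* Vectors being rows, the library's Jacobian matrix acts on the right: it is
   the transpose of the usual one, and A v is written v *m A. *)
Definition dtheta d K n (g : 'rV[R]_d -> 'rV[R[i]]_K -> 'rV[R]_n)
    (theta : 'rV[R]_d) (z : 'rV[R[i]]_K) : 'M[R]_(d, n) :=
  jacobian (fun x => g x z) theta.

Section Data.
Context {d m K : nat}.
Implicit Types (f : 'rV[R]_d -> 'rV[R]_m -> 'rV[R]_d)
  (g fhat ffhat Uhat : 'rV[R]_d -> 'rV[R[i]]_K -> 'rV[R]_d)
  (omega phi : 'rV[R]_K) (theta : 'rV[R]_d) (z : 'rV[R[i]]_K).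

Definition Df f (G0 : 'rV[R]_K -> 'rV[R]_m) g theta z : 'rV[R]_d :=
  f theta (Gmap G0 z) *m dtheta g theta z.

Definition fbar f (G0 : 'rV[R]_K -> 'rV[R]_m) theta : 'rV[R]_d :=
  pi_mean (fun z => f theta (Gmap G0 z)).

Definition Upsilon f (G0 : 'rV[R]_K -> 'rV[R]_m) fhat theta z : 'rV[R]_d :=
  - (f theta (Gmap G0 z) *m dtheta fhat theta z).

Definition Upsilon_bar f (G0 : 'rV[R]_K -> 'rV[R]_m) fhat theta : 'rV[R]_d :=
  pi_mean (Upsilon f G0 fhat theta).

(* [ghat] solves Poisson's equation with forcing function [g - gbar] along every
   trajectory of the clock process. *)
Definition poisson omega g (gbar : 'rV[R]_d -> 'rV[R]_d)
    (ghat : 'rV[R]_d -> 'rV[R[i]]_K -> 'rV[R]_d) : Prop :=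
  forall theta phi (t0 t1 : R), 0 <= t0 -> t0 <= t1 ->
    ghat theta (Phi omega phi t0) =
    vintegral `[t0, t1] (fun t => g theta (Phi omega phi t) - gbar theta) +
    ghat theta (Phi omega phi t1).

Definition lipschitz_in_theta g : Prop :=
  exists L : R, forall theta theta' z, Omega z ->
    `|g theta' z - g theta z| <= L * `|theta' - theta|.

(* Solutions on [0, +oo[, starting from an arbitrary initial condition. *)
Definition ode_solution (F : R -> 'rV[R]_d -> 'rV[R]_d) (x : R -> 'rV[R]_d) :
  Prop :=
  {within `[0, +oo[, continuous x} /\
  (forall t : R, 0 < t -> is_derive t 1 x (F t (x t))).

Definition globally_asymptotically_stable (F : 'rV[R]_d -> 'rV[R]_d)
    (xstar : 'rV[R]_d) : Prop :=
  [/\ (forall x, F x = 0 <-> x = xstar),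
      (forall e : R, 0 < e -> exists2 del : R, 0 < del &
         forall x, ode_solution (fun=> F) x -> `|x 0 - xstar| < del ->
           forall t, 0 <= t -> `|x t - xstar| < e) &
      (forall x, ode_solution (fun=> F) x -> x t @[t --> +oo] --> xstar)].

Definition QSA0 omega (G0 : 'rV[R]_K -> 'rV[R]_m) : Prop :=
  (exists2 c, taylor_expansion G0 c &
     (\esum_(alpha in setT) `|c alpha|%:E < +oo)%E) /\
  [/\ (forall i, exists a b : nat,
         [/\ (0 < a)%N, (0 < b)%N & omega 0 i = ln (a%:R / b%:R)]),
      (forall i, 0 < omega 0 i) &
      (forall q : 'I_K -> rat,
         \sum_i ratr (q i) * omega 0 i = 0 -> forall i, q i = 0)].

Definition QSA1 (a : R -> R) : Prop :=
  [/\ (forall t, 0 <= t -> 0 <= a t),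
      (forall s t, 0 <= s -> s <= t -> a t <= a s),
      a t @[t --> +oo] --> 0 &
      (\int[mu]_(t in `[0%R, +oo[) (a t)%:E = +oo)%E].

Definition QSA2 f (G0 : 'rV[R]_K -> 'rV[R]_m) : Prop :=
  exists Lf : R,
    (forall theta theta',
       `|fbar f G0 theta' - fbar f G0 theta| <= Lf * `|theta' - theta|) /\
    (forall theta theta' (x x' : 'rV[R]_m),
       `|f theta' x - f theta x| + `|f theta x' - f theta x| <=
       Lf * (`|theta' - theta| + `|x' - x|)).

Definition QSA3a f (G0 : 'rV[R]_K -> 'rV[R]_m) : Prop :=
  exists (V : 'rV[R]_d -> R) (delta0 : R) (S : set 'rV[R]_d),
    [/\ (forall theta, 0 <= V theta),
        (exists L : R, forall theta theta',
           `|V theta' - V theta| <= L * `|theta' - theta|),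
        0 < delta0, compact S &
        forall x, ode_solution (fun=> fbar f G0) x -> forall t, 0 <= t ->
          ~ S (x t) ->
          differentiable V (x t) /\
          'd V (x t) (fbar f G0 (x t)) <= - delta0 * `|x t|].

Definition QSA3b f (G0 : 'rV[R]_K -> 'rV[R]_m) : Prop :=
  exists finf : 'rV[R]_d -> 'rV[R]_d,
    [/\ (forall theta,
           c^-1 *: fbar f G0 (c *: theta) @[c --> +oo] --> finf theta),
        continuous finf &
        globally_asymptotically_stable finf 0].

Definition QSA3 f (G0 : 'rV[R]_K -> 'rV[R]_m) : Prop :=
  (exists theta_star, globally_asymptotically_stable (fbar f G0) theta_star) /\
  (QSA3a f G0 \/ QSA3b f G0).

Definition QSA5 f (G0 : 'rV[R]_K -> 'rV[R]_m) omega
    (fhat ffhat Uhat : 'rV[R]_d -> 'rV[R[i]]_K -> 'rV[R]_d) : Prop :=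
  [/\ (forall theta,
         [/\ ergodic omega (fun z => f theta (Gmap G0 z)),
             ergodic omega (fhat theta) &
             ergodic omega (dtheta fhat theta)] /\
         [/\ ergodic omega (Upsilon f G0 fhat theta),
             ergodic omega (ffhat theta) &
             ergodic omega (Uhat theta)]),
      [/\ poisson omega (fun theta z => f theta (Gmap G0 z)) (fbar f G0) fhat,
          forall theta, pi_mean (fhat theta) = 0,
          C1_torus fhat &
          forall theta, pi_mean (dtheta fhat theta) = 0],
      [/\ C1_torus ffhat, C1_torus Uhat,
          poisson omega fhat (fun=> 0) ffhat &
          poisson omega (Upsilon f G0 fhat) (Upsilon_bar f G0 fhat) Uhat],
      (forall theta, pi_mean (ffhat theta) = 0 /\ pi_mean (Uhat theta) = 0) &
      lipschitz_in_theta fhat /\ lipschitz_in_theta Uhat].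

Definition Wpert f (G0 : 'rV[R]_K -> 'rV[R]_m) omega phi (a r : R -> R) ffhat Uhat
    (Theta : R -> 'rV[R]_d) (i : nat) (t : R) : 'rV[R]_d :=
  let Phit := Phi omega phi t in
  match i with
  | 0%N => - Df f G0 Uhat (Theta t) Phit
           + (r t / a t) *: Df f G0 ffhat (Theta t) Phit
  | 1%N => - Df f G0 ffhat (Theta t) Phit + Uhat (Theta t) Phit
  | _ => ffhat (Theta t) Phit
  end.

(* Smooth test functions with compact support in ]0, +oo[. *)
Definition test_function (psi : R -> R) : Prop :=
  (forall (n : nat) (t : R), derivable (derive1n n psi) t 1) /\
  exists s t : R, 0 < s /\ forall u, ~~ (s <= u <= t) -> psi u = 0.

(* W = \sum_(i < 3) a^(2-i) (d/dt)^i W_i on ]0, +oo[.  In the mean flow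
   representation W_2 is built from a function assumed C^1 only and W_1 from its
   theta-derivative, so that W_2'' and W_1' need not exist classically.  The
   derivatives are thus taken in the sense of distributions; at each time where
   W_1 has a classical derivative, W_2 is moreover required to be twice
   differentiable, and the identity to hold with classical derivatives. *)
Definition perturbation_sum (a : R -> R) (Wi : nat -> R -> 'rV[R]_d)
    (W : R -> 'rV[R]_d) : Prop :=
  [/\ (forall psi, test_function psi ->
         vintegral `]0, +oo[ (fun t => psi t *: W t) =
         \sum_(i < 3) (-1) ^+ i *:
           vintegral `]0, +oo[
             (fun t => derive1n i (fun s => a s ^+ (2 - i) * psi s) t *: Wi i t)),
      (forall t : R, 0 < t -> derivable (Wi 2) t 1) &
      (forall t : R, 0 < t -> derivable (Wi 1) t 1 ->
         derivable (derive1 (Wi 2)) t 1 /\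
         W t = \sum_(i < 3) a t ^+ (2 - i) *: derive1n i (Wi i) t)].

End Data.
End Qsa.

(* Main.v *)
Require Import Defs.
From HB Require Import structures.
From mathcomp Require Import all_boot all_order all_algebra.
From mathcomp Require Import complex.
From mathcomp Require Import all_classical all_reals all_analysis.
From mathcomp Require Import ring lra.

Set Implicit Arguments.
Unset Strict Implicit.
Unset Printing Implicit Defensive.

Import Order.TTheory GRing.Theory Num.Theory.
Import numFieldNormedType.Exports.

Local Open Scope classical_set_scope.
Local Open Scope ring_scope.

(** Why the theorem holds.

    Mean flow representation. Differentiate g (Theta_t, Phi_t) for a C^1 function
    g: the motion of Theta contributes a_t [Df g], and the motion of the clock
    contributes the derivative of g along the flow of the clock, which Poisson's
    equation computes when g is one of the three solutions
    ([poisson_derive], [flow_diff], [trajectory_derive]). This gives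
      (fhat)' = a Df fhat - (f - fbar),    (ffhat)' = a Df ffhat - fhat,
      (Uhat)' = a Df Uhat - (Upsilon - Upsilon_bar),
    and Upsilon = - Df fhat. Take W = f - fbar + a Upsilon_bar, so that the
    differential equation holds by definition. Eliminating f - fbar, then fhat,
    exhibits W as the combination of derivatives of W_0, W_1 and W_2; since
    Df ffhat need not be differentiable, the elimination is made against a test
    function, where the difference of the two sides is the derivative of a
    function with compact support ([distribution_identity]).

    Vanishing of Upsilon_bar. The signal G depends on z through z + 1/z only, so
    that f (theta, G z) is even under z -> 1/z. The even part of fhat is then
    constant along the flow, and its time average is zero: fhat is odd
    ([poisson_solution_odd]). Hence Upsilon is odd, and its mean is zero
    ([odd_ergodic_mean0]). Reflection turns a forward orbit into a backward one,
    and forward averages control backward ones because the clock comes back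
    arbitrarily close to its initial state ([torus_recurrence],
    [backward_average]).

    Ultimate boundedness. The probing signal is bounded and f is Lipschitz in it
    with a constant that does not depend on theta, so f (theta, xi_t) stays within
    a fixed distance B of fbar theta ([forcing_deviation_le]). In the time scale
    A_t = int_0^t a, the trajectory thus solves the mean flow up to an error
    bounded by B. With a Lyapunov function V, outside a large ball V (Theta_t)
    decreases in proportion to the displacement of Theta, which bounds every
    excursion ([lyapunov_ultimate_bound]). With a stable scaling limit, over a
    window of fixed length in the new time scale a large Theta is at least halved,
    by comparison with the scaled flow ([scaling_window],
    [scaling_ultimate_bound]). *)

(** * Continuity *)

Section continuity.

Lemma continuous_pair (S T U : topologicalType) (g : S -> T) (h : S -> U) :
  continuous g -> continuous h -> continuous (fun s => (g s, h s)).
Proof. by move=> gc hc s; apply: cvg_pair; [exact: gc|exact: hc]. Qed.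

Lemma continuous_compT (S T U : topologicalType) (g : S -> T) (h : T -> U) :
  continuous g -> continuous h -> continuous (fun s => h (g s)).
Proof. by move=> gc hc s; apply: continuous_comp; [exact: gc|exact: hc]. Qed.

Lemma continuous_fst (S T : topologicalType) : continuous (@fst S T).
Proof. by move=> s; exact: cvg_fst. Qed.

Lemma continuous_snd (S T : topologicalType) : continuous (@snd S T).
Proof. by move=> s; exact: cvg_snd. Qed.

Lemma continuous_pairr (S T : topologicalType) (x : S) :
  continuous (fun y : T => (x, y)).
Proof. by apply: continuous_pair => [y|y]; [exact: cvg_cst|exact: cvg_id]. Qed.

Lemma continuous_slice (S T U : topologicalType) (F : S * T -> U) (x : S) :
  continuous F -> continuous (fun y => F (x, y)).
Proof. by move=> Fc; exact: continuous_compT (@continuous_pairr _ _ x) Fc. Qed.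

Lemma max0_continuous (R : realType) : continuous (fun t : R => Num.max 0 t).
Proof.
move=> t.
by apply: (@continuous_max _ _ (fun=> 0) idfun t); [exact: cvg_cst|exact: cvg_id].
Qed.

(** Freezing a trajectory before time 0 makes it continuous on the whole line,
    without changing it at positive times. *)
Lemma continuous_max0 (R : realType) (V : topologicalType) (g : R -> V) :
  {within `[0, +oo[, continuous g} -> continuous (fun t : R => g (Num.max 0 t)).
Proof.
move=> gc t.
have m0 : (`[0, +oo[%classic : set R) (Num.max 0 t).
  by rewrite /= in_itv/= andbT le_max lexx.
have gt : g @ within `[0, +oo[ (nbhs (Num.max 0 t)) --> g (Num.max 0 t).
  by rewrite (nbhs_subspace_in m0); exact: gc.
apply: cvg_comp gt => P; rewrite /within/= => nearP.
have mc : {for t, continuous (fun s : R => Num.max 0 s)} by exact: max0_continuous.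
apply: (@filterS _ (nbhs (t : R)) _ _ _ _ (mc _ nearP)) => s; apply.
by rewrite /= in_itv/= andbT le_max lexx.
Qed.

End continuity.

(** * Primitives and increments *)

Section calculus.
Context {R : realType}.
Local Notation mu := (@lebesgue_measure R).
Implicit Types (u : R -> R) (a b t : R).

Lemma continuous_integrable u a b :
  continuous u -> mu.-integrable `[a, b] (EFin \o u).
Proof.
move=> uc; apply: continuous_compact_integrable; first exact: segment_compact.
exact: continuous_subspaceT.
Qed.

Lemma is_derive_continuous (V : normedModType R) (U : R -> V) (x : R) (dU : V) :
  is_derive x 1 U dU -> {for x, continuous U}.
Proof.
by move=> [/derivable1_diffP + _]; exact: differentiable_continuous.
Qed.

(** The integral from - N to x is differentiable at the points x > - N only; its
    increments from 0 do not depend on N, which glues these functions into a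
    primitive on the whole line. *)
Lemma exists_primitive u : continuous u ->
  exists2 U : R -> R, (forall t, is_derive t 1 U (u t)) & U 0 = 0.
Proof.
move=> uc; pose I (N x : R) := \int[mu]_(t in `[- N, x]) u t.
have IE (N N' x : R) : N' <= N -> - N' <= x ->
    I N x = I N (- N') + I N' x.
  move=> NN' xN'; rewrite /I.
  have := @Rintegral_itvB R u (BLeft (- N)) (BRight x) (- N').
  move=> /(_ (continuous_integrable _ _ uc)).
  rewrite !bnd_simp lerN2 => /(_ NN' xN') e.
  have e' := @Rintegral_itv_obnd_cbnd R (- N') (BRight x) u.
  rewrite -e'; first by rewrite -e addrC subrK.
  apply: integrableS (continuous_integrable (- N') x uc) => //.
  by apply: subset_itvr; rewrite bnd_simp.
pose U x := I (`|x| + 1) x - I (`|x| + 1) 0.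
have UE (N x : R) : `|x| <= N -> 0 <= N -> U x = I N x - I N 0.
  move=> xN N0; rewrite /U.
  have E (M M' y : R) : 0 <= M' -> M' <= M -> `|y| <= M' ->
      I M y - I M 0 = I M' y - I M' 0.
    move=> M'0 M'M yM'; rewrite (IE M M' y)// ?(IE M M' 0) ?oppr_le0//.
      by rewrite opprD addrACA subrr add0r.
    by rewrite lerNl; apply: le_trans yM'; rewrite -normrN ler_norm.
  have [h|/ltW h] := leP (`|x| + 1) N.
    by rewrite -(E N)// ?addr_ge0// lerDl.
  by rewrite (E _ N).
exists U; last first.
  by rewrite /U subrr.
move=> t.
pose N := `|t| + 1.
have N0 : 0 <= N by rewrite addr_ge0.
apply: (@near_eq_is_derive _ _ _ (fun x => I N x - I N 0)).
  near=> x; rewrite (UE N) //.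
  near: x; apply/nbhs_ballP; exists 1 => //= y; rewrite /ball/= => ty.
  rewrite -[y](subrK t) (le_trans (ler_normD _ _))// addrC lerD2l.
  by rewrite distrC ltW.
have -> : u t = u t - 0 by rewrite subr0.
apply: is_deriveB.
have Nt : - N < t.
  by rewrite ltrNl (le_lt_trans (ler_norm _))// normrN ltrDl.
have tt1 : t < t + 1 by rewrite ltrDl.
have := continuous_FTC1 tt1 (continuous_integrable (- N) (t + 1) uc).
move=> /(_ Nt (uc t)) [dI eI].
by split; [exact: dI | rewrite -derive1E; exact: eI].
Unshelve. all: by end_near. Qed.

Lemma Rintegral_primitive u (U : R -> R) a b : a <= b -> continuous u ->
  (forall t, is_derive t 1 U (u t)) -> \int[mu]_(t in `[a, b]) u t = U b - U a.
Proof.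
rewrite le_eqVlt => /predU1P[->|ab] uc dU.
  by rewrite set_itv1 Rintegral_set1 subrr.
have Uc : continuous U by move=> x; exact: is_derive_continuous (dU x).
rewrite /Rintegral (@continuous_FTC2 _ u U)//.
- exact: continuous_subspaceT.
- split.
  + by move=> x _; have := dU x.
  + by apply: cvg_at_right_filter; exact: Uc.
  + by apply: cvg_at_left_filter; exact: Uc.
- by move=> x _; rewrite derive1E; have [] := dU x.
Qed.

End calculus.

Section increments.
Context {R : realType}.

Lemma mx_norm_le p q (M : 'M[R]_(p, q)) (c : R) :
  0 <= c -> (forall i j, `|M i j| <= c) -> `|M| <= c.
Proof.
by move=> c0 Mc; rewrite /Num.norm/= mx_normrE; apply/bigmax_le => // -[i j] _.
Qed.

Lemma coord_norm_le p q (M : 'M[R]_(p, q)) i j : `|M i j| <= `|M|.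
Proof.
rewrite [leRHS]/Num.norm/= mx_normrE.
exact: (@le_bigmax _ _ _ 0 (fun ij => `|M ij.1 ij.2|) (i, j)).
Qed.

Lemma cvg_mx (T : Type) (F : set_system T) {FF : Filter F} p q
    (M : T -> 'M[R]_(p, q)) (L : 'M[R]_(p, q)) :
  (forall i j, M x i j @[x --> F] --> L i j) -> M @ F --> L.
Proof.
move=> ML; apply/cvgrPdist_le => e e0.
have : \forall x \near F, forall ij : 'I_p * 'I_q,
    `|L ij.1 ij.2 - M x ij.1 ij.2| <= e.
  by apply: filter_forall => -[i j]; move/cvgrPdist_le : (ML i j); exact.
apply: filterS => x Mx; apply: mx_norm_le; first exact: ltW.
by move=> i j; rewrite !mxE; exact: (Mx (i, j)).
Qed.

Lemma cvg_coord (T : Type) (F : set_system T) {FF : Filter F} p q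
    (M : T -> 'M[R]_(p, q)) (L : 'M[R]_(p, q)) i j :
  M @ F --> L -> M x i j @[x --> F] --> L i j.
Proof.
by move=> ML; exact: (cvg_comp _ _ ML (@coord_continuous R p q i j L)).
Qed.

(** The mean value theorem in the form used throughout: increments are compared
    through pointwise bounds on derivatives, instead of integrals of these. *)
Lemma increment_le (g dg h dh : R -> R) (a b : R) : a <= b ->
  {within `[a, b], continuous g} -> {within `[a, b], continuous h} ->
  (forall t, a < t < b -> is_derive t 1 g (dg t)) ->
  (forall t, a < t < b -> is_derive t 1 h (dh t)) ->
  (forall t, a < t < b -> dg t <= dh t) ->
  g b - g a <= h b - h a.
Proof.
rewrite le_eqVlt => /predU1P[->|ab] gc hc dG dH gh; first by rewrite !subrr.
have dhg (t : R) : t \in `]a, b[ -> is_derive t 1 (h - g) (dh t - dg t).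
  by rewrite in_itv/= => tab; apply: is_deriveB; [exact: dH|exact: dG].
have hgc : {within `[a, b], continuous (h - g)}.
  by move=> x; apply: cvgB; [exact: hc|exact: gc].
have [c] := MVT ab dhg hgc.
rewrite in_itv/= => cab e; rewrite -subr_ge0.
have -> : h b - h a - (g b - g a) = (h - g) b - (h - g) a.
  by rewrite !fctE; ring.
by rewrite e mulr_ge0// subr_ge0 ?gh// ltW.
Qed.

Lemma is_derive_coord n (G : R -> 'rV[R]_n) (t : R) (dG : 'rV[R]_n) i :
  is_derive t 1 G dG -> is_derive t 1 (fun s => G s 0 i) (dG 0 i).
Proof.
move=> [/[dup] d /derivable_mxP dGi eG]; split; first exact: dGi.
by rewrite -eG derive_mx// mxE.
Qed.

Lemma is_derive_row n (G : R -> 'rV[R]_n) (t : R) (dG : 'rV[R]_n) :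
  (forall i, is_derive t 1 (fun s => G s 0 i) (dG 0 i)) -> is_derive t 1 G dG.
Proof.
move=> dGi.
have d : derivable G t 1.
  by apply/derivable_mxP => i j; rewrite (ord1 i); have [] := dGi j.
split=> //; rewrite derive_mx//; apply/rowP => j; rewrite mxE.
by have [] := dGi j.
Qed.

Lemma norm_increment1_le (g dg h dh : R -> R) (a b : R) : a <= b ->
  {within `[a, b], continuous g} -> {within `[a, b], continuous h} ->
  (forall t, a < t < b -> is_derive t 1 g (dg t)) ->
  (forall t, a < t < b -> is_derive t 1 h (dh t)) ->
  (forall t, a < t < b -> `|dg t| <= dh t) ->
  `|g b - g a| <= h b - h a.
Proof.
move=> ab gc hc dgt dht le_dg.
rewrite ler_norml lerNl; apply/andP; split.
- have -> : - (g b - g a) = - g b - - g a by rewrite opprD.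
  apply: (@increment_le (fun t => - g t) (fun t => - dg t) h dh) => //.
  + by move=> x; apply: cvgN; exact: gc.
  + by move=> t /dgt dgtt; exact: is_deriveN.
  + by move=> t /le_dg; rewrite -normrN; exact: le_trans (ler_norm _).
- apply: (increment_le ab gc hc dgt dht) => t /le_dg.
  exact: le_trans (ler_norm _).
Qed.

Lemma norm_increment_le n (G dG : R -> 'rV[R]_n) (h dh : R -> R) (a b : R) :
  a <= b ->
  {within `[a, b], continuous G} -> {within `[a, b], continuous h} ->
  (forall t, a < t < b -> is_derive t 1 G (dG t)) ->
  (forall t, a < t < b -> is_derive t 1 h (dh t)) ->
  (forall t, a < t < b -> `|dG t| <= dh t) ->
  `|G b - G a| <= h b - h a.
Proof.
move=> ab Gc hc dGt dht le_dG.
have h0 : 0 <= h b - h a.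
  rewrite -[leLHS](subrr ((fun=> 0 : R) a)).
  apply: (@increment_le (fun=> 0) (fun=> 0) h dh) => //.
  - by move=> x; exact: cvg_cst.
  - by move=> t tab; exact: le_trans (normr_ge0 _) (le_dG t tab).
apply: mx_norm_le => // i j; rewrite (ord1 i) !mxE {i}.
apply: (@norm_increment1_le (fun t => G t 0 j) (fun t => dG t 0 j) h dh) => //.
- by move=> x; apply: cvg_coord; exact: Gc.
- by move=> t /dGt; exact: is_derive_coord.
- by move=> t /le_dG; apply: le_trans; exact: coord_norm_le.
Qed.

(** Time averages are handled through a primitive U, so that estimates on them
    reduce to estimates on increments. *)
Lemma time_average_primitive p q (u : R -> 'M[R]_(p, q)) (l : 'M[R]_(p, q)) i j
    (U : R -> R) : continuous (fun t => u t i j) ->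
  (forall t : R, is_derive t 1 U (u t i j)) -> U 0 = 0 ->
  time_average u T @[T --> +oo] --> l ->
  T^-1 * U T @[T --> +oo] --> l i j.
Proof.
move=> uc dU U0 ul.
have h : time_average u T i j @[T --> +oo] --> l i j by exact: cvg_coord.
apply: cvg_trans h; apply: near_eq_cvg; near=> T.
have T0 : 0 <= T by near: T; exact: nbhs_pinfty_ge (num_real 0).
by rewrite mxE (Rintegral_primitive T0 uc dU) U0 subr0.
Unshelve. all: by end_near. Qed.

End increments.

(** * Ordinary differential equations *)

Section gronwall_inequality.
Context {R : realType}.

Lemma is_derive_expR_comp (A : R -> R) (t dA k : R) : is_derive t 1 A dA ->
  is_derive t 1 (fun s => expR (k * A s)) (k * dA * expR (k * A t)).
Proof.
move=> hA.
have kA : is_derive t 1 (fun s => k * A s) (k * dA) by exact: is_deriveZ.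
have := @is_derive1_comp R expR (fun s => k * A s) t _ _ (is_derive_expR _) kA.
by rewrite [expR _ * _]mulrC.
Qed.

(** Gronwall's inequality in the time scale A. Let S be the maximum of
    exp (- 2 L A) `|D|. The derivative of D is at most that of
    (S / 2) exp (2 L A) + eta A, and evaluating the increment at the point where
    the maximum is attained bounds S by 2 (eta A + D0). *)
Lemma gronwall n (D dD : R -> 'rV[R]_n) (A dA : R -> R) (L eta D0 t0 t1 : R) :
  0 <= L -> 0 <= eta -> t0 <= t1 -> A t0 = 0 ->
  {within `[t0, t1], continuous D} -> {within `[t0, t1], continuous A} ->
  (forall t, t0 < t < t1 -> is_derive t 1 D (dD t)) ->
  (forall t, t0 < t < t1 -> is_derive t 1 A (dA t)) ->
  (forall t, t0 < t < t1 -> 0 <= dA t) ->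
  (forall t, t0 < t < t1 -> `|dD t| <= dA t * (L * `|D t| + eta)) ->
  `|D t0| <= D0 ->
  forall t, t0 <= t <= t1 ->
    `|D t| <= 2 * expR (2 * L * A t) * (eta * A t1 + D0).
Proof.
move=> L0 eta0 t01 At0 Dc Ac dDt dAt dA0 dDle Dt0.
have cont_sub (c : R) (V : topologicalType) (g : R -> V) : t0 <= c <= t1 ->
    {within `[t0, t1], continuous g} -> {within `[t0, c], continuous g}.
  move=> /andP[_ ct1]; apply: continuous_subspaceW.
  by apply: subset_itvl; rewrite bnd_simp.
have Amono (c e : R) : t0 <= c -> c <= e -> e <= t1 -> A c <= A e.
  move=> t0c ce et1; rewrite -subr_ge0.
  rewrite -[leLHS](subrr 0); apply: (@increment_le _ (fun=> 0) (fun=> 0) A dA).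
  - exact: ce.
  - by move=> x; exact: cvg_cst.
  - apply: continuous_subspaceW Ac.
    by apply: subset_itv; rewrite bnd_simp.
  - move=> t /andP[ct te]; apply: dAt.
    by rewrite (le_lt_trans t0c ct) (lt_le_trans te et1).
  - move=> t /andP[ct te]; apply: dA0.
    by rewrite (le_lt_trans t0c ct) (lt_le_trans te et1).
pose w t := expR (- (2 * L) * A t) * `|D t|.
have wc : {within `[t0, t1], continuous w}.
  move=> x; apply: cvgM.
    apply: continuous_cvg; first exact: continuous_expR.
    by apply: cvgM; [exact: cvg_cst|exact: Ac].
  by apply: (cvg_norm (Dc x)).
have [c] := EVT_max t01 wc; rewrite in_itv/= => ct01 wmax.
pose S := w c.
have S0 : 0 <= S by rewrite mulr_ge0// expR_ge0.
have DS t : t0 <= t <= t1 -> `|D t| <= S * expR (2 * L * A t).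
  move=> tt; have := wmax t; rewrite in_itv/= => /(_ tt).
  by rewrite /w mulNr expRN mulrC ler_pdivrMr ?expR_gt0.
have Dc_eq : `|D c| = S * expR (2 * L * A c).
  by rewrite /S /w mulNr expRN mulrAC mulVf ?mul1r// gt_eqF ?expR_gt0.
have [t0c ct1] := andP ct01.
pose h t := S / 2 * expR (2 * L * A t) + eta * A t.
have inc : `|D c - D t0| <= h c - h t0.
  apply: (@norm_increment_le _ _ D dD h
    (fun t => S / 2 * (2 * L * dA t * expR (2 * L * A t)) + eta * dA t)).
  - exact: t0c.
  - exact: cont_sub Dc.
  - apply: (cont_sub _ _ _ ct01) => x.
    apply: cvgD.
      apply: cvgM; first exact: cvg_cst.
      apply: continuous_cvg; first exact: continuous_expR.
      by apply: cvgM; [exact: cvg_cst|exact: Ac].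
    by apply: cvgM; [exact: cvg_cst|exact: Ac].
  - by move=> t /andP[tt tc]; apply: dDt; rewrite tt (lt_le_trans tc).
  - move=> t /andP[tt tc].
    have dAt' : is_derive t 1 A (dA t) by apply: dAt; rewrite tt (lt_le_trans tc).
    by apply: is_deriveD; apply: is_deriveZ; exact: is_derive_expR_comp.
  - move=> t /andP[tt tc].
    have tt1 : t < t1 by apply: lt_le_trans tc _.
    apply: le_trans (dDle t _) _; first by rewrite tt.
    have -> : S / 2 * (2 * L * dA t * expR (2 * L * A t)) + eta * dA t =
              dA t * (L * (S * expR (2 * L * A t)) + eta) by field.
    by rewrite ler_wpM2l ?dA0 ?tt// lerD2r ler_wpM2l// DS// !ltW.
have Ac0 : 0 <= A c by rewrite -At0 Amono.
have Sle : S <= 2 * (eta * A t1 + D0).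
  have : `|D c| <= D0 + (h c - h t0).
    rewrite -[D c](subrK (D t0)) (le_trans (ler_normD _ _))// addrC.
    by rewrite lerD.
  rewrite Dc_eq /h At0 mulr0 expR0 mulr0 addr0 mulr1 => Se.
  have e1 : 1 <= expR (2 * L * A c) by rewrite -expR0 ler_expR !mulr_ge0.
  have AA : eta * A c <= eta * A t1 by rewrite ler_wpM2l// Amono.
  have : S <= S * expR (2 * L * A c) by rewrite ler_peMr.
  lra.
move=> t tt; apply: le_trans (DS t tt) _.
by rewrite [leRHS]mulrAC ler_wpM2r// expR_ge0.
Qed.

End gronwall_inequality.

Section picard_lindelof.
Context {R : realType}.

Lemma exists_half_pow_lt (M e : R) : 0 < e -> exists k, M / 2 ^+ k < e.
Proof.
move=> e0; exists (Num.truncn (M / e)).+1.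
rewrite ltr_pdivrMr ?exprn_gt0// mulrC -ltr_pdivrMr//.
apply: lt_le_trans (Num.Theory.truncnS_gt _) _.
by rewrite -natrX ler_nat ltnW// ltn_expl.
Qed.

Lemma le0_half_pow (M y : R) : (forall k, y <= M / 2 ^+ k) -> y <= 0.
Proof.
move=> yM; rewrite leNgt; apply/negP => y0.
by have [k] := exists_half_pow_lt M y0; rewrite ltNge yM.
Qed.

Lemma exists_vprimitive n (u : R -> 'rV[R]_n) : continuous u ->
  exists2 U : R -> 'rV[R]_n, (forall t : R, is_derive t 1 U (u t)) & U 0 = 0.
Proof.
move=> uc.
have /choice[U UP] : forall i, exists U : R -> R,
    (forall t : R, is_derive t 1 U (u t 0 i)) /\ U 0 = 0.
  move=> i; have uic : continuous (fun t => u t 0 i).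
    by move=> t; apply: cvg_coord; exact: uc.
  by have [U dU U0] := exists_primitive uic; exists U.
exists (fun t => \row_i U i t).
- move=> t; apply: is_derive_row => i.
  have -> : (fun s => (\row_j U j s) 0 i) = U i.
    by apply/funext => s; rewrite mxE.
  exact: (UP i).1.
- by apply/rowP => i; rewrite !mxE (UP i).2.
Qed.

Lemma half_pow_cvg n (x : nat -> 'rV[R]_n) (C : R) :
  (forall k, `|x k.+1 - x k| <= C / 2 ^+ k) ->
  exists l, forall k, `|l - x k| <= 2 * C / 2 ^+ k.
Proof.
move=> xC.
have xkj k j : `|x (k + j)%N - x k| <= 2 * C / 2 ^+ k - 2 * C / 2 ^+ (k + j).
  elim: j => [|j IH]; first by rewrite addn0 !subrr normr0.
  rewrite addnS -[x _](subrK (x (k + j)%N)) -addrA.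
  apply: le_trans (ler_normD _ _) _.
  apply: le_trans (lerD (xC _) IH) _.
  rewrite exprS -[X in _ <= _ - X]mulf_div divff// mul1r.
  lra.
have C0 : 0 <= C by have := le_trans (normr_ge0 _) (xC 0%N); rewrite expr0 divr1.
have xkj' k j : `|x (k + j)%N - x k| <= 2 * C / 2 ^+ k.
  apply: le_trans (xkj k j) _; rewrite lerBlDr lerDl.
  by rewrite divr_ge0 ?mulr_ge0 ?exprn_ge0.
have xcvg : cvgn x.
  apply/cauchy_cvgP/cauchy_ballP => e e0.
  have [k ke] := exists_half_pow_lt (4 * C) e0.
  exists (x @` [set j | (k <= j)%N], x @` [set j | (k <= j)%N]) => /=.
    by split; exists k => // j /= kj; exists j.
  move=> [_ _] [/= [i ki <-] [j kj <-]].
  rewrite -ball_normE/=; apply: le_lt_trans ke.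
  rewrite -[x i](subrK (x k)) -addrA (le_trans (ler_normD _ _))//.
  have := xkj' k (i - k)%N; have := xkj' k (j - k)%N.
  rewrite !subnKC// (distrC (x k)).
  lra.
exists (limn x) => k.
have nc : `|x j - x k| @[j --> \oo] --> `|limn x - x k|.
  by apply: cvg_norm; apply: cvgB; [exact: xcvg|exact: cvg_cst].
rewrite -(cvg_lim _ nc)//; apply: limr_le; first by apply/cvg_ex; eexists; exact: nc.
exists k => // j /= kj; have := xkj' k (j - k)%N.
by rewrite subnKC.
Qed.

Lemma lipschitz_continuous (U V : normedModType R) (F : U -> V) (L : R) :
  (forall x y, `|F y - F x| <= L * `|y - x|) -> continuous F.
Proof.
move=> FL x; apply/cvgrPdist_le => e e0.
pose M := `|L| + 1.
have M0 : 0 < M by rewrite ltr_wpDl.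
near=> y; rewrite distrC; apply: le_trans (FL _ _) _.
apply: (@le_trans _ _ (M * `|y - x|)).
  by rewrite ler_wpM2r// (le_trans (ler_norm L))// lerDl.
rewrite mulrC -ler_pdivlMr// distrC; near: y.
by apply: cvgr_dist_le; [exact: cvg_id|exact: divr_gt0].
Unshelve. all: by end_near. Qed.

(** Global existence for a globally Lipschitz vector field. Iterates are functions
    of `|t|, hence continuous on the whole line, although the equation is only
    solved for t > 0. *)
Lemma picard n (F : 'rV[R]_n -> 'rV[R]_n) (L : R) (x0 : 'rV[R]_n) : 0 < L ->
  (forall x y, `|F y - F x| <= L * `|y - x|) ->
  exists x : R -> 'rV[R]_n, [/\ continuous x, x 0 = x0 &
    forall t : R, 0 < t -> is_derive t 1 x (F (x t))].
Proof.
move=> L0 FL; have Fc := lipschitz_continuous FL.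
have /choice[prim primP] : forall u : R -> 'rV[R]_n, exists U : R -> 'rV[R]_n,
    continuous u -> (forall t : R, is_derive t 1 U (u t)) /\ U 0 = 0.
  move=> u; have [uc|nuc] := pselect (continuous u); last by exists u.
  by have [U dU U0] := exists_vprimitive uc; exists U.
pose P (x : R -> 'rV[R]_n) (t : R) := x0 + prim (F \o x) `|t|.
have Fxc (x : R -> 'rV[R]_n) : continuous x -> continuous (F \o x).
  by move=> xc t; apply: continuous_comp; [exact: xc|exact: Fc].
have primc (x : R -> 'rV[R]_n) : continuous x -> continuous (prim (F \o x)).
  by move=> /Fxc/primP[dU _] t; exact: is_derive_continuous (dU t).
have Pc (x : R -> 'rV[R]_n) : continuous x -> continuous (P x).
  move=> xc t; apply: cvgD; first exact: cvg_cst.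
  by apply: continuous_cvg; [exact: primc|exact: norm_continuous].
(* The exponential weight turns the Picard map into a contraction with ratio 1/2
   on the whole half-line. *)
pose e (t : R) := expR (2 * L * `|t|).
have contr (x y : R -> 'rV[R]_n) (B : R) : continuous x -> continuous y ->
    0 <= B -> (forall t, `|x t - y t| <= B * e t) ->
    forall t, `|P x t - P y t| <= B / 2 * e t.
  move=> xc yc B0 xyB t; rewrite /P opprD addrACA subrr add0r.
  have [dx x00] := primP _ (Fxc _ xc); have [dy y00] := primP _ (Fxc _ yc).
  have dd (s : R) : is_derive s 1 (fun r => prim (F \o x) r - prim (F \o y) r)
      (F (x s) - F (y s)).
    by apply: is_deriveB.
  have de (s : R) : is_derive s 1 (fun r => B / 2 * expR (2 * L * r))
      (B / 2 * (2 * L * 1 * expR (2 * L * s))).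
    by apply: is_deriveZ; exact: is_derive_expR_comp.
  have := @norm_increment_le _ _ (fun s => prim (F \o x) s - prim (F \o y) s)
    _ _ _ 0 `|t| (normr_ge0 t) _ _ (fun s _ => dd s) (fun s _ => de s).
  rewrite x00 y00 subrr subr0 mulr0 expR0 !mulr1.
  move=> le_inc; apply: (@le_trans _ _ (B / 2 * expR (2 * L * `|t|) - B / 2)).
    apply: le_inc.
    - apply: continuous_subspaceT => s; exact: is_derive_continuous (dd s).
    - apply: continuous_subspaceT => s; exact: is_derive_continuous (de s).
    - move=> s /andP[s0 _]; apply: le_trans (FL _ _) _.
      have := xyB s; rewrite /e gtr0_norm// => xyBs.
      have -> : B / 2 * (2 * L * expR (2 * L * s)) =
                L * (B * expR (2 * L * s)) by field.
      by rewrite ler_wpM2l// ltW.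
  by rewrite gerBl divr_ge0.
pose X k := iter k P (fun=> x0).
have Xc k : continuous (X k).
  elim: k => [|k IH]; first by move=> t; exact: cvg_cst.
  exact: Pc.
have [C C0 X1] : exists2 C : R, 0 <= C & forall t, `|X 1%N t - X 0%N t| <= C * e t.
  pose C : R := `|F x0| / (2 * L).
  have C0 : 0 <= C by rewrite divr_ge0// mulr_ge0// ltW.
  exists C => // t.
  rewrite /X/= /P addrC addKr.
  have [dx x00] := primP _ (Fxc _ (Xc 0%N)).
  have de (s : R) : is_derive s 1 (fun r => C * expR (2 * L * r))
      (C * (2 * L * 1 * expR (2 * L * s))).
    by apply: is_deriveZ; exact: is_derive_expR_comp.
  have := @norm_increment_le _ _ (prim (F \o X 0%N)) _ _ _ 0 `|t|
    (normr_ge0 t) _ _ (fun s _ => dx s) (fun s _ => de s).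
  rewrite x00 subr0 mulr0 expR0 !mulr1 => le_inc.
  apply: (@le_trans _ _ (C * expR (2 * L * `|t|) - C)).
    apply: le_inc.
    - apply: continuous_subspaceT => s; exact: is_derive_continuous (dx s).
    - apply: continuous_subspaceT => s; exact: is_derive_continuous (de s).
    - move=> s /andP[s0 _]; rewrite /= mulrA /C divfK ?mulf_neq0 ?gt_eqF//.
      rewrite ler_peMr// -expR0 ler_expR !mulr_ge0// ltW//.
  by rewrite gerBl.
have C2k (k : nat) : 0 <= 2 * C / 2 ^+ k.
  by rewrite divr_ge0 ?mulr_ge0 ?exprn_ge0.
have Cek (t : R) (k : nat) : 0 <= C * e t / 2 ^+ k.
  by rewrite divr_ge0 ?exprn_ge0 ?mulr_ge0 ?expR_ge0.
have Xk t k : `|X k.+1 t - X k t| <= C * e t / 2 ^+ k.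
  elim: k t => [|k IH] t; first by rewrite expr0 divr1.
  rewrite mulrAC exprS invfM mulrCA [2^-1 * _]mulrC.
  apply: (contr _ _ _ (Xc k.+1) (Xc k)); first by rewrite divr_ge0 ?exprn_ge0.
  by move=> s; rewrite mulrAC.
have /choice[x xP] := fun t => half_pow_cvg (Xk t).
have xX t k : `|x t - X k t| <= 2 * C / 2 ^+ k * e t.
  by apply: le_trans (xP t k) _; rewrite mulrA mulrAC.
have xc : continuous x.
  move=> t; apply/cvgrPdist_le => eps eps0.
  have [k ke] := exists_half_pow_lt (2 * C * expR (2 * L * (`|t| + 1)))
    (divr_gt0 eps0 (ltr0n R 3)).
  have near_x s : `|s| <= `|t| + 1 -> `|x s - X k s| <= eps / 3.
    move=> st; apply: le_trans (xX s k) _; apply: le_trans (ltW ke).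
    rewrite mulrAC ler_wpM2r ?invr_ge0 ?exprn_ge0//.
    have C2 : 0 <= 2 * C by rewrite mulr_ge0.
    have L2 : 0 <= 2 * L by rewrite mulr_ge0// ltW.
    by rewrite /e ler_wpM2l// ler_expR ler_wpM2l.
  near=> s.
  have h1 : `|x t - X k t| <= eps / 3 by rewrite near_x ?lerDl.
  have h2 : `|x s - X k s| <= eps / 3.
    rewrite near_x// -[s](subrK t) (le_trans (ler_normD _ _))// addrC lerD2l.
    rewrite distrC; near: s.
    by apply: cvgr_dist_le; [exact: cvg_id|exact: ltr01].
  have h3 : `|X k t - X k s| <= eps / 3.
    near: s.
    by apply: cvgr_dist_le; [exact: Xc|exact: divr_gt0].
  have -> : x t - x s = (x t - X k t) + (X k t - X k s) - (x s - X k s).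
    by rewrite opprB [X in _ = X]addrA !addrA subrK subrK.
  apply: le_trans (ler_normB _ _) _.
  have := ler_normD (x t - X k t) (X k t - X k s); lra.
have xE t : x t = P x t.
  apply/eqP; rewrite -subr_eq0 -normr_le0.
  apply: (@le0_half_pow (4 * C * e t)) => k.
  have h1 := xX t k.+1.
  have h2 := contr _ _ (2 * C / 2 ^+ k) (Xc k) xc.
  have h3 : `|X k.+1 t - P x t| <= 2 * C / 2 ^+ k / 2 * e t.
    apply: (h2 _ _ t); last by move=> s; rewrite distrC.
    exact: C2k.
  rewrite -[x t](subrK (X k.+1 t)) -addrA; apply: le_trans (ler_normD _ _) _.
  apply: le_trans (lerD h1 h3) _.
  rewrite exprS invfM.
  have p0 := Cek t k.
  have -> : 2 * C * (2^-1 / 2 ^+ k) * e t + 2 * C / 2 ^+ k / 2 * e t =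
    2 * (C * e t / 2 ^+ k) by field; rewrite expf_neq0.
  have -> : 4 * C * e t / 2 ^+ k = 4 * (C * e t / 2 ^+ k) by rewrite -!mulrA.
  lra.
have [dU U0] := primP _ (Fxc _ xc).
exists x; split => //; first by rewrite xE /P normr0 U0 addr0.
move=> t t0; apply: (@near_eq_is_derive _ _ _ (fun s => x0 + prim (F \o x) s)).
  near=> s; rewrite [RHS]xE /P gtr0_norm//.
  near: s; exact: lt_nbhsr.
rewrite -[F (x t)]add0r; apply: is_deriveD; exact: dU.
Unshelve. all: by end_near. Qed.

End picard_lindelof.

(** * Ultimate boundedness of perturbed flows *)

Section ultimate_boundedness.
Context {R : realType}.

Lemma is_derive_comp_diff (U V : normedModType R) (H : U -> V) (p : R -> U)
    (t : R) (dp : U) : differentiable H (p t) -> is_derive t 1 p dp ->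
  is_derive t 1 (fun s => H (p s)) ('d H (p t) dp).
Proof.
move=> dH [/[dup] dvp /derivable1_diffP pd pE].
have Hpd : differentiable (H \o p) t by exact: differentiable_comp.
have Hpv : derivable (H \o p) t 1 by exact/derivable1_diffP.
split; first exact: Hpv.
transitivity ('D_1 (H \o p) t); first by [].
by rewrite deriveE// diff_comp//= -pE deriveE.
Qed.

(** The perturbation of the mean flow is not in the direction where V is known to
    decrease; this bounds its effect on V. *)
Lemma lipschitz_diff_le (U : normedModType R) (V : U -> R) (LV : R) x v :
  (forall y z, `|V z - V y| <= LV * `|z - y|) -> differentiable V x ->
  `|'d V x v| <= LV * `|v|.
Proof.
move=> VL dV; rewrite -deriveE//.
have dxv : derivable V x v by exact: diff_derivable.
have nc : `|h^-1 *: (V (h *: v + x) - V x)| @[h --> 0^'] --> `|'D_v V x|.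
  by apply: cvg_norm; exact: dxv.
rewrite -(cvg_lim _ nc)//; apply: limr_le; first by apply/cvg_ex; eexists; exact: nc.
near=> h.
have h0 : h != 0 by near: h; exact: nbhs_dnbhs_neq.
rewrite normrM normfV ler_pdivrMl ?normr_gt0//.
apply: le_trans (VL _ _) _.
by rewrite addrK normrZ mulrCA.
Unshelve. all: by end_near. Qed.

(** The maximum of the compact set of times in [s, t] at which N is at most r. *)
Lemma last_entrance (N : R -> R) (r s t : R) : continuous N -> s <= t ->
  N s <= r -> r < N t ->
  exists u, [/\ s <= u, u < t, N u <= r & forall v, u < v <= t -> r < N v].
Proof.
move=> Nc st Ns Nt.
pose E := `[s, t]%classic `&` [set u | N u <= r].
have Ec : compact E.
  apply: compact_closedI; first exact: segment_compact.
  by apply: (@closed_comp _ _ N [set x | x <= r]) => [x _|]; [exact: Nc|exact: closed_le].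
have E0 : E !=set0 by exists s; split => //=; rewrite in_itv/= lexx st.
have idc : {within E, continuous (@idfun R)}.
  by apply: continuous_subspaceT => x; exact: cvg_id.
have [u] := compact_EVT_max E0 Ec idc.
rewrite inE => -[/=]; rewrite in_itv/= => /andP[su ut] Nu umax.
have utlt : u < t.
  by rewrite lt_neqAle ut andbT; apply/eqP => e; move: Nt; rewrite -e ltNge Nu.
exists u; split => // v /andP[uv vt]; rewrite ltNge; apply/negP => Nv.
have : v <= u.
  apply: umax; rewrite inE; split => //=.
  by rewrite in_itv/= vt (le_trans su (ltW uv)).
by rewrite leNgt uv.
Qed.

(** A is the time scale of the gain a, a primitive of a that maps [0, +oo[
    increasingly onto an interval that is unbounded above. *)
Definition clock (A a : R -> R) : Prop :=
  [/\ continuous A,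
      forall t : R, 0 < t -> is_derive t 1 A (a t) /\ 0 <= a t,
      forall s t : R, 0 <= s -> s < t -> A s < A t &
      forall s T : R, 0 <= s -> 0 <= T -> exists2 t, s <= t & A t = A s + T].

(** The value g of the right-hand side is existentially quantified, so that the
    forcing that produces it does not appear. *)
Definition perturbed_solution n (a : R -> R) (F : 'rV[R]_n -> 'rV[R]_n) (B : R)
    (x : R -> 'rV[R]_n) : Prop :=
  continuous x /\
  forall t : R, 0 < t ->
    exists2 g : 'rV[R]_n, is_derive t 1 x (a t *: g) & `|g - F (x t)| <= B.

(** As V may be bounded, its decrease alone does not confine x. Outside a ball of
    radius r, the derivative of V is at most - (delta / 2) a `|x|, while x' is at
    most K a `|x|: hence V pays for the displacement of x, and as V >= 0 an
    excursion from the ball, where V is bounded, has bounded size. The ball is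
    reached because A tends to infinity. *)
Lemma lyapunov_ultimate_bound n (A a : R -> R) (F : 'rV[R]_n -> 'rV[R]_n)
    (V : 'rV[R]_n -> R) (L LV B delta r0 : R) :
  clock A a -> 0 <= L -> 0 <= LV -> 0 <= B -> 0 < delta ->
  (forall x y, `|F y - F x| <= L * `|y - x|) ->
  (forall x, 0 <= V x) ->
  (forall x y, `|V y - V x| <= LV * `|y - x|) ->
  (forall x, r0 < `|x| -> differentiable V x /\ 'd V x (F x) <= - delta * `|x|) ->
  exists b, forall x, perturbed_solution a F B x ->
    exists T : R, forall t : R, T <= t -> `|x t| <= b.
Proof.
move=> [Ac dA Amono Ainf] L0 LV0 B0 delta0 FL V0 VL Vdecr.
pose r := 1 + `|r0| + 2 * LV * B / delta.
pose K := L + `|F 0| + B + 1.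
have q0 : 0 <= 2 * LV * B / delta by rewrite divr_ge0 ?mulr_ge0// ltW.
have r1 : 1 <= r by rewrite /r -addrA lerDl addr_ge0.
have r0r : r0 <= r.
  by rewrite /r; have := ler_norm r0; lra.
have K0 : 0 < K by rewrite /K; have := normr_ge0 (F 0); lra.
have [kappa kappa0 kappaK] : exists2 kappa, 0 < kappa & kappa * K = delta / 2.
  by exists (delta / 2 / K); rewrite ?divr_gt0// divfK// gt_eqF.
exists (r + (V 0 + LV * r) / kappa) => x [xc dx].
have gle (t : R) g : r < `|x t| -> `|g - F (x t)| <= B -> `|g| <= K * `|x t|.
  move=> rx gB; have x1 : 1 <= `|x t| by apply: le_trans r1 (ltW rx).
  have h1 : `|F (x t)| <= L * `|x t| + `|F 0|.
    rewrite -[F (x t)](subrK (F 0)); apply: le_trans (ler_normD _ _) _.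
    by rewrite lerD2r; have := FL 0 (x t); rewrite subr0.
  have : `|g| <= B + (L * `|x t| + `|F 0|).
    rewrite -[g](subrK (F (x t))); apply: le_trans (ler_normD _ _) _.
    exact: lerD.
  have : (B + `|F 0|) * 1 <= (B + `|F 0|) * `|x t| by rewrite ler_wpM2l// addr_ge0.
  rewrite /K; lra.
have dVle (t : R) g : r < `|x t| -> `|g - F (x t)| <= B ->
    differentiable V (x t) /\ 'd V (x t) g <= - (delta / 2 * `|x t|).
  move=> rx gB; have [Vd VF] := Vdecr _ (le_lt_trans r0r rx).
  split => //; rewrite -[g](subrK (F (x t))) linearD/=.
  have h1 := lipschitz_diff_le (g - F (x t)) VL Vd.
  have h2 := ler_norm ('d V (x t) (g - F (x t))).
  have h3 : LV * `|g - F (x t)| <= LV * B by rewrite ler_wpM2l.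
  have h4 : LV * B <= delta / 2 * `|x t|.
    have -> : LV * B = delta / 2 * (2 * LV * B / delta) by field; rewrite gt_eqF.
    rewrite ler_wpM2l ?divr_ge0 ?ltW//; apply: le_lt_trans rx.
    by rewrite /r lerDr addr_ge0.
  lra.
(* Outside the ball of radius r, V (x t) decreases at least as fast as
   kappa * x t moves. *)
have /choice[gx gxP] : forall t : R, exists g, 0 < t ->
    is_derive t 1 x (a t *: g) /\ `|g - F (x t)| <= B.
  move=> t; have [t0|] := ltP 0 t; last by exists 0.
  by have [g] := dx t t0; exists g.
have Vxc : continuous (fun t => V (x t)).
  move=> t; apply: continuous_comp; first exact: xc.
  have Vc := @lipschitz_continuous R _ _ V LV VL.
  exact: Vc.
have dVx (t : R) : 0 < t -> r < `|x t| ->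
    is_derive t 1 (fun s => - V (x s)) (- 'd V (x t) (a t *: gx t)).
  move=> t0 rx; have [dxt gB] := gxP t t0; apply: is_deriveN.
  by apply: is_derive_comp_diff => //; exact: (dVle _ _ rx gB).1.
have dVx_ge (t : R) : 0 < t -> r < `|x t| ->
    a t * (delta / 2 * `|x t|) <= - 'd V (x t) (a t *: gx t).
  move=> t0 rx; have [dxt gB] := gxP t t0; have [_ dle] := dVle _ _ rx gB.
  by rewrite linearZ/= lerNr -mulrN ler_wpM2l//; have [] := dA t t0.
have [T T0 xT] : exists2 T, 0 < T & `|x T| <= r.
  apply: contrapT => /forall2NP xr.
  have {}xr (t : R) : 0 < t -> r < `|x t|.
    by move=> t0; have [//|/negP] := xr t; rewrite -ltNge.
  have d2 : 0 < delta / 2 by rewrite divr_gt0.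
  have M0 : 0 <= (V (x 1) + 1) / (delta / 2).
    by apply: divr_ge0; [rewrite addr_ge0|exact: ltW].
  have [t t1 At] := Ainf 1 _ ler01 M0.
  have : delta / 2 * A t - delta / 2 * A 1 <= - V (x t) - - V (x 1).
    apply: (@increment_le _ (fun s => delta / 2 * A s) (fun s => delta / 2 * a s)
      (fun s => - V (x s)) (fun s => - 'd V (x s) (a s *: gx s))).
    - exact: t1.
    - by apply: continuous_subspaceT => s; apply: cvgM; [exact: cvg_cst|exact: Ac].
    - by apply: continuous_subspaceT => s; apply: cvgN; exact: Vxc.
    - move=> s /andP[s1 _]; apply: is_deriveZ.
      by have [] := dA s (lt_trans ltr01 s1).
    - move=> s /andP[/(lt_trans ltr01) s0 _]; apply: dVx => //; exact: xr.
    - move=> s /andP[/(lt_trans ltr01) s0 _]; apply: le_trans (dVx_ge s s0 (xr _ s0)).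
      have [_ as0] := dA s s0.
      rewrite mulrC ler_wpM2l//; apply: ler_peMr; first exact: ltW.
      exact: le_trans r1 (ltW (xr _ s0)).
  rewrite At mulrDr addrAC subrr add0r mulrC divfK ?gt_eqF//.
  have := V0 (x t); lra.
exists T => t Tt.
have LVr0 : 0 <= (V 0 + LV * r) / kappa.
  apply: divr_ge0; last exact: ltW.
  by apply: addr_ge0 => //; apply: mulr_ge0 => //; exact: le_trans ler01 r1.
have [xr|xr] := leP `|x t| r; first by rewrite (le_trans xr)// lerDl.
have nxc : continuous (fun t => `|x t|) by move=> s; apply: cvg_norm; exact: xc.
have [u [Tu ut xu uv]] := last_entrance nxc Tt xT xr.
have u0 : 0 < u by exact: lt_le_trans T0 Tu.
have : `|kappa *: x t - kappa *: x u| <= - V (x t) - - V (x u).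
  apply: (@norm_increment_le _ _ (fun s => kappa *: x s)
    (fun s => kappa *: (a s *: gx s))
    (fun s => - V (x s)) (fun s => - 'd V (x s) (a s *: gx s))).
  - exact: ltW.
  - by apply: continuous_subspaceT => s; apply: cvgZ; [exact: cvg_cst|exact: xc].
  - by apply: continuous_subspaceT => s; apply: cvgN; exact: Vxc.
  - move=> s /andP[us st]; apply: is_deriveZ.
    by have [] := gxP s (lt_trans u0 us).
  - move=> s /andP[us st]; apply: dVx; first exact: lt_trans us.
    by apply: uv; rewrite us ltW.
  - move=> s /andP[us st]; have s0 := lt_trans u0 us.
    have rxs : r < `|x s| by apply: uv; rewrite us ltW.
    apply: le_trans (dVx_ge s s0 rxs).
    have [_ as0] := dA s s0; have [_ gB] := gxP s s0.
    rewrite !normrZ (ger0_norm as0) (gtr0_norm kappa0) mulrCA ler_wpM2l//.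
    apply: (@le_trans _ _ (kappa * (K * `|x s|))).
      by rewrite ler_wpM2l ?(ltW kappa0)// gle.
    by rewrite mulrA kappaK.
rewrite -scalerBr normrZ (gtr0_norm kappa0) opprK => inc.
have Vu : V (x u) <= V 0 + LV * r.
  have := VL 0 (x u); rewrite subr0 => /(le_trans (ler_norm _)) h.
  have : LV * `|x u| <= LV * r by rewrite ler_wpM2l.
  lra.
have : `|x t - x u| <= (V 0 + LV * r) / kappa.
  by rewrite ler_pdivlMr// mulrC; have := V0 (x t); lra.
rewrite -[x t in X in _ -> X](subrK (x u)) => h.
by apply: le_trans (ler_normD _ _) _; rewrite addrC lerD.
Qed.

(** A solution of an autonomous equation on [0, +oo[, extended continuously to the
    whole line, so that it can be composed and shifted freely. *)
Definition is_flow n (F : 'rV[R]_n -> 'rV[R]_n) (phi : R -> 'rV[R]_n) : Prop :=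
  continuous phi /\ forall t : R, 0 < t -> is_derive t 1 phi (F (phi t)).

Lemma flow_dist_le n (F : 'rV[R]_n -> 'rV[R]_n) (L : R) (phi psi : R -> 'rV[R]_n) :
  0 <= L -> (forall x y, `|F y - F x| <= L * `|y - x|) ->
  is_flow F phi -> is_flow F psi ->
  forall t, 0 <= t ->
    `|phi t - psi t| <= 2 * expR (2 * L * t) * `|phi 0 - psi 0|.
Proof.
move=> L0 FL [phic dphi] [psic dpsi] t t0.
have := @gronwall R n (fun s => phi s - psi s) (fun s => F (phi s) - F (psi s))
  id (fun=> 1) L 0 `|phi 0 - psi 0| 0 t L0 (lexx 0) t0 erefl.
rewrite mul0r add0r; apply => //.
- by apply: continuous_subspaceT => s; apply: cvgB; [exact: phic|exact: psic].
- by apply: continuous_subspaceT => s; exact: cvg_id.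
- by move=> s /andP[s0 _]; apply: is_deriveB; [exact: dphi|exact: dpsi].
- by move=> s _; rewrite mul1r addr0 FL.
- by rewrite t0 lexx.
Qed.

Lemma is_derive_comp1 (V : normedModType R) (phi : R -> V) (p : R -> R) (t dp : R)
    (dphi : V) : is_derive (p t) 1 phi dphi -> is_derive t 1 p dp ->
  is_derive t 1 (fun s => phi (p s)) (dp *: dphi).
Proof.
move=> [dphi1 <-] dpt.
have phid : differentiable phi (p t) by exact/derivable1_diffP.
have := is_derive_comp_diff phid dpt.
by rewrite deriv1E// derive1E.
Qed.

Lemma closed_norm_ball_compact n (r : R) : compact [set x : 'rV[R]_n | `|x| <= r].
Proof.
apply: bounded_closed_compact.
  exists r; split; first exact: num_real.
  by move=> M rM x /= xr; exact: le_trans xr (ltW rM).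
apply: (@closed_comp _ _ (fun x : 'rV[R]_n => `|x|) [set s | s <= r]) => [x _|].
  exact: norm_continuous.
exact: closed_le.
Qed.

Lemma near_dist_lt (V : normedModType R) (x : V) (e : R) :
  0 < e -> \forall y \near x, `|x - y| < e.
Proof. by move=> e0; apply: cvgr_dist_lt; [exact: cvg_id|exact: e0]. Qed.

(** Attraction brings the solution from x into the neighborhood of 0 granted by
    stability, at some time T0; by continuous dependence the solutions from nearby
    points are in it too at time T0, and they remain small at all later times. *)
Lemma near_flow_small n (F : 'rV[R]_n -> 'rV[R]_n) (L e : R) (x : 'rV[R]_n) :
  0 < L -> 0 < e ->
  (forall x y, `|F y - F x| <= L * `|y - x|) ->
  globally_asymptotically_stable F 0 ->
  \forall y \near x & T \near +oo%R,
    forall phi, is_flow F phi -> phi 0 = y -> `|phi T| <= e.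
Proof.
move=> L0 e0 FL [_ stab conv].
have [del del0 delP] := stab _ e0.
have sol phi : is_flow F phi -> ode_solution (fun=> F) phi.
  by move=> [phic dphi]; split => //; exact: continuous_subspaceT.
have shift phi (T : R) : is_flow F phi -> 0 <= T ->
    is_flow F (fun t => phi (t + T)).
  move=> [phic dphi] T0; split=> t.
    apply: continuous_comp; last exact: phic.
    by apply: cvgD; [exact: cvg_id|exact: cvg_cst].
  move=> t0; rewrite -[F _]scale1r; apply: is_derive_comp1.
    exact/dphi/ltr_pwDl.
  by rewrite -[X in is_derive _ _ _ X]addr0; exact: is_deriveD.
have [psi [psic psi0 dpsi]] := picard x L0 FL.
have psiF : is_flow F psi by split.
have d2 : 0 < del / 2 by exact: divr_gt0.
have : \forall t \near +oo, `|psi t| < del / 2.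
  move/cvgrPdist_lt : (conv _ (sol _ psiF)) => /(_ _ d2); apply: filterS => t.
  by rewrite sub0r normrN.
move=> psi_small.
have [T0 [psiT0 T00]] := filter_ex (filterI psi_small (nbhs_pinfty_ge (num_real 0))).
pose M := 2 * expR (2 * L * T0).
have M0 : 0 < M by rewrite mulr_gt0// expR_gt0.
exists ([set y | `|x - y| < del / 2 / M], [set T | T0 <= T]) => /=.
  split; last exact: nbhs_pinfty_ge (num_real T0).
  exact: (@near_dist_lt 'rV[R]_n x _ (divr_gt0 d2 M0)).
move=> [y T] /= [xy T0T] phi phiF phi0.
have phiT0 : `|phi T0| < del.
  rewrite -[phi T0](subrK (psi T0)); apply: le_lt_trans (ler_normD _ _) _.
  have := flow_dist_le (ltW L0) FL phiF psiF T00.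
  rewrite phi0 psi0 -/M (distrC y) => h.
  have : M * `|x - y| < del / 2 by rewrite mulrC -ltr_pdivlMr.
  by have := psiT0; lra.
have := delP _ (sol _ (shift _ _ phiF T00)).
rewrite add0r subr0 => /(_ phiT0 (T - T0)).
by rewrite subrK subr0 subr_ge0 => /(_ T0T) /ltW.
Qed.

(** Compactness of the unit ball makes the time of attraction uniform. *)
Lemma gas_uniform n (F : 'rV[R]_n -> 'rV[R]_n) (L e : R) : 0 < L -> 0 < e ->
  (forall x y, `|F y - F x| <= L * `|y - x|) ->
  globally_asymptotically_stable F 0 ->
  exists2 T : R, 0 < T & forall phi, is_flow F phi -> `|phi 0| <= 1 ->
    `|phi T| <= e.
Proof.
move=> L0 e0 FL gas.
have /compact_near_coveringP Kcov := @closed_norm_ball_compact n 1.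
have small : \forall T \near +oo%R, [set x : 'rV[R]_n | `|x| <= 1] `<=`
    (fun x => forall phi, is_flow F phi -> phi 0 = x -> `|phi T| <= e).
  by apply: Kcov => x _; exact: near_flow_small L0 e0 FL gas.
have [T [Tsmall T0]] := filter_ex (filterI small (nbhs_pinfty_gt (num_real 0))).
by exists T => // phi phiF phi0; exact: (Tsmall (phi 0) phi0 phi phiF).
Qed.

(** Pointwise convergence of equi-Lipschitz functions is uniform on compact
    sets. *)
Lemma uniform_scaling_limit n (F G : 'rV[R]_n -> 'rV[R]_n) (L e r : R) :
  0 < L -> 0 < e ->
  (forall x y, `|F y - F x| <= L * `|y - x|) ->
  (forall x y, `|G y - G x| <= L * `|y - x|) ->
  (forall x, c^-1 *: F (c *: x) @[c --> +oo] --> G x) ->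
  exists2 c0 : R, 0 < c0 & forall c x, c0 <= c -> `|x| <= r ->
    `|c^-1 *: F (c *: x) - G x| <= e.
Proof.
move=> L0 e0 FL GL FG.
have /compact_near_coveringP Kcov := @closed_norm_ball_compact n r.
have e3 : 0 < e / 3 by exact: divr_gt0.
have : \forall c \near +oo%R, [set x : 'rV[R]_n | `|x| <= r] `<=`
    (fun x => 0 < c -> `|c^-1 *: F (c *: x) - G x| <= e).
  apply: Kcov => x _.
  exists ([set y | `|x - y| < e / 3 / L],
          [set c | `|G x - c^-1 *: F (c *: x)| <= e / 3]) => /=.
    split; last by move/cvgrPdist_le : (FG x) => /(_ _ e3).
    exact: (@near_dist_lt 'rV[R]_n x _ (divr_gt0 e3 L0)).
  move=> [y c] /= [xy Gc] c0.
  have xy' : L * `|x - y| <= e / 3 by rewrite mulrC -ler_pdivlMr// ltW.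
  have h1 : `|c^-1 *: F (c *: y) - c^-1 *: F (c *: x)| <= e / 3.
    rewrite -scalerBr normrZ gtr0_norm ?invr_gt0// ler_pdivrMl//.
    apply: le_trans (FL _ _) _; rewrite -scalerBr normrZ gtr0_norm// mulrCA.
    by rewrite distrC ler_wpM2l// ltW.
  have h2 := le_trans (GL y x) xy'.
  have -> : c^-1 *: F (c *: y) - G y =
    (c^-1 *: F (c *: y) - c^-1 *: F (c *: x)) + (G x - G y)
    - (G x - c^-1 *: F (c *: x)).
    by apply/rowP => i; rewrite !mxE; ring.
  apply: le_trans (ler_normB _ _) _.
  have := ler_normD (c^-1 *: F (c *: y) - c^-1 *: F (c *: x)) (G x - G y); lra.
move=> [M [_ near_M]].
exists (Num.max 1 (M + 1)); first by rewrite lt_max ltr01.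
move=> c x; rewrite ge_max => /andP[c1 Mc] x1.
apply: near_M => //; last exact: lt_le_trans c1.
by apply: lt_le_trans Mc; rewrite ltrDl.
Qed.

Lemma scaling_limit_lipschitz n (F G : 'rV[R]_n -> 'rV[R]_n) (L : R) :
  (forall x y, `|F y - F x| <= L * `|y - x|) ->
  (forall x, c^-1 *: F (c *: x) @[c --> +oo] --> G x) ->
  forall x y, `|G y - G x| <= L * `|y - x|.
Proof.
move=> FL FG x y.
have nc : `|c^-1 *: F (c *: y) - c^-1 *: F (c *: x)| @[c --> +oo] --> `|G y - G x|.
  by apply: cvg_norm; apply: cvgB; exact: FG.
rewrite -(cvg_lim _ nc)//; apply: limr_le; first by apply/cvg_ex; eexists; exact: nc.
near=> c.
have c0 : 0 < c by near: c; exact: nbhs_pinfty_gt (num_real 0).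
rewrite -scalerBr normrZ gtr0_norm ?invr_gt0// ler_pdivrMl//.
by apply: le_trans (FL _ _) _; rewrite -scalerBr normrZ gtr0_norm// mulrCA.
Unshelve. all: by end_near. Qed.

(** Let c be the larger of `|x t0| and c0, and let phi be the solution of the
    limit equation that starts from x t0 / c, in the unit ball. The function
    c phi (A t - A t0) almost solves the perturbed equation, up to an error
    B + c / (8 M T), so by Gronwall's inequality it stays within c / 4 of x on a window of
    length T; and `|phi T| <= 1 / 4. *)
Lemma scaling_window n (A a : R -> R) (F G : 'rV[R]_n -> 'rV[R]_n) (L B : R) :
  clock A a -> 0 < L -> 0 <= B ->
  (forall x y, `|F y - F x| <= L * `|y - x|) ->
  (forall x, c^-1 *: F (c *: x) @[c --> +oo] --> G x) ->
  globally_asymptotically_stable G 0 ->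
  exists T c0 M : R, [/\ 0 < T, 0 < c0, 0 <= M &
    forall x, perturbed_solution a F B x ->
    forall t0 t1, 0 <= t0 -> t0 <= t1 -> A t1 = A t0 + T ->
      `|x t1| <= Num.max `|x t0| c0 / 2 /\
      forall t, t0 <= t <= t1 -> `|x t| <= M * Num.max `|x t0| c0].
Proof.
move=> [Ac dA Amono Ainf] L0 B0 FL FG gas.
have GL := scaling_limit_lipschitz FL FG.
have G0 : G 0 = 0 by case: gas => + _ _ => /(_ 0) [_ ->].
have q0 : (0 : R) < 4^-1 by rewrite invr_gt0.
have [T T0 gasT] := gas_uniform L0 q0 GL gas.
have [M M0 ME] : exists2 M : R, 0 < M & M = 2 * expR (2 * L * T).
  by eexists; last reflexivity; rewrite mulr_gt0// expR_gt0.
have MT0 : 0 < M * T by rewrite mulr_gt0.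
have e0 : 0 < (8 * (M * T))^-1 by rewrite invr_gt0 mulr_gt0.
have [c1 c10 FGc] := uniform_scaling_limit M L0 e0 FL GL FG.
pose c0 := c1 + 8 * (M * T) * B.
have c00 : 0 < c0 by rewrite ltr_wpDr// !mulr_ge0// ltW.
exists T, c0, (M + 1); split => //; first by rewrite addr_ge0// ltW.
move=> x [xc dx] t0 t1 t00 t01 At1.
set c := Num.max _ _.
have xc0 : `|x t0| <= c by rewrite le_max lexx.
have c0c : c0 <= c by rewrite le_max lexx orbT.
have c_gt0 : 0 < c by exact: lt_le_trans c0c.
have c1c : c1 <= c.
  by apply: le_trans c0c; rewrite /c0 lerDl !mulr_ge0// ltW.
have [phi [phic phi0 dphi]] := picard (c^-1 *: x t0) L0 GL.
have phiF : is_flow G phi by split.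
have phi01 : `|phi 0| <= 1.
  by rewrite phi0 normrZ gtr0_norm ?invr_gt0// ler_pdivrMl// mulr1.
have phiM s : 0 <= s <= T -> `|phi s| <= M.
  move=> /andP[s0 sT].
  have zeroF : is_flow G (fun=> 0).
    by split=> [s'|s' _]; [exact: cvg_cst|rewrite G0; exact: is_derive_cst].
  have := flow_dist_le (ltW L0) GL phiF zeroF s0; rewrite !subr0 => /le_trans; apply.
  rewrite ME -[leRHS]mulr1; apply: ler_pM => //.
  by rewrite ler_wpM2l// ler_expR ler_wpM2l// mulr_ge0// ltW.
pose tau t := A t - A t0.
have tau0 : tau t0 = 0 by rewrite /tau subrr.
have tauT t : t0 <= t <= t1 -> 0 <= tau t <= T.
  move=> /andP[]; rewrite le_eqVlt => /predU1P[<-|tt0].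
    by rewrite tau0 lexx (ltW T0).
  rewrite le_eqVlt => /predU1P[->|tt1].
    by rewrite /tau At1 addrAC subrr add0r lexx (ltW T0).
  rewrite /tau subr_ge0 ltW ?Amono//= lerBlDl -At1 ltW// Amono//.
  exact: le_trans t00 (ltW tt0).
pose z t := c *: phi (tau t).
have tauc : continuous tau.
  by move=> t; apply: cvgB; [exact: Ac|exact: cvg_cst].
have zc : continuous z.
  move=> t; apply: cvgZ; first exact: cvg_cst.
  by apply: continuous_cvg; [exact: phic|exact: tauc].
have /choice[gx gxP] : forall t : R, exists g, 0 < t ->
    is_derive t 1 x (a t *: g) /\ `|g - F (x t)| <= B.
  move=> t; have [t_gt0|] := ltP 0 t; last by exists 0.
  by have [g] := dx t t_gt0; exists g.
have pos (t : R) : t0 < t -> 0 < t by exact: le_lt_trans.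
have dtau (t : R) : t0 < t -> is_derive t 1 tau (a t).
  move=> /pos t_gt0; rewrite -[a t]subr0; apply: is_deriveB.
  exact: (dA t t_gt0).1.
have dz (t : R) : t0 < t -> is_derive t 1 z (c *: (a t *: G (phi (tau t)))).
  move=> tt0; apply: is_deriveZ; apply: is_derive_comp1; last exact: dtau.
  by apply: dphi; rewrite subr_gt0 Amono.
have D_le t : t0 <= t <= t1 -> `|x t - z t| <= c / 4.
  move=> tt.
  have := @gronwall R n (fun s => x s - z s)
    (fun s => a s *: gx s - c *: (a s *: G (phi (tau s))))
    tau a L (B + c * (8 * (M * T))^-1) 0 t0 t1 (ltW L0) _ t01 tau0 _ _ _ _ _ _ _ t tt.
  have -> : tau t1 = T by rewrite /tau At1 addrAC subrr add0r.
  rewrite addr0 => Dt; apply: le_trans (Dt _ _ _ _ _ _ _ _) _ => {Dt}.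
  - by rewrite addr_ge0// mulr_ge0// ltW.
  - by apply: continuous_subspaceT => s; apply: cvgB; [exact: xc|exact: zc].
  - exact: continuous_subspaceT.
  - move=> s /andP[s0 _]; apply: is_deriveB; last exact: dz.
    by have [] := gxP s (pos s s0).
  - by move=> s /andP[s0 _]; exact: dtau.
  - by move=> s /andP[s0 _]; have [] := dA s (pos s s0).
  - move=> s /andP[s0 s1]; have [_ as0] := dA s (pos s s0).
    have [_ gB] := gxP s (pos s s0).
    rewrite scalerA mulrC -scalerA -scalerBr normrZ ger0_norm// ler_wpM2l//.
    have ss : t0 <= s <= t1 by rewrite !ltW.
    have -> : gx s - c *: G (phi (tau s)) = (gx s - F (x s)) + (F (x s) - F (z s))
        + (F (z s) - c *: G (phi (tau s))).
      by apply/rowP => i; rewrite !mxE; ring.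
    have h1 := FL (z s) (x s).
    have h2 : `|F (z s) - c *: G (phi (tau s))| <= c * (8 * (M * T))^-1.
      rewrite -ler_pdivrMl// -[X in X * _]gtr0_norm ?invr_gt0// -normrZ scalerBr.
      rewrite scalerA mulVf ?gt_eqF// scale1r; apply: FGc => //.
      exact/phiM/tauT.
    apply: le_trans (ler_normD _ _) _.
    have := ler_normD (gx s - F (x s)) (F (x s) - F (z s)); lra.
  - by rewrite /z tau0 phi0 scalerA mulfV ?gt_eqF// scale1r subrr normr0.
  have /andP[tau_ge0 tau_leT] := tauT t tt.
  apply: (@le_trans _ _ (M * ((B + c * (8 * (M * T))^-1) * T))).
    rewrite ler_wpM2r//.
      apply: mulr_ge0; last exact: ltW.
      by rewrite addr_ge0// mulr_ge0 ?(ltW e0) ?(ltW c_gt0).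
    by rewrite ME ler_wpM2l// ler_expR ler_wpM2l// mulr_ge0// ltW.
  have -> : M * ((B + c * (8 * (M * T))^-1) * T) = M * T * B + c / 8.
    by field; rewrite !gt_eqF.
  have : 8 * (M * T) * B <= c by apply: le_trans c0c; rewrite /c0 lerDr ltW.
  lra.
have xz t : x t = (x t - z t) + z t by rewrite subrK.
split.
  have t11 : t0 <= t1 <= t1 by rewrite t01 lexx.
  have zt1 : `|z t1| <= c / 4.
    rewrite /z normrZ gtr0_norm// ler_wpM2l ?(ltW c_gt0)//.
    rewrite /tau At1 addrAC subrr add0r; exact: gasT.
  rewrite xz; apply: le_trans (ler_normD _ _) _.
  by have := D_le _ t11; lra.
move=> t tt; rewrite xz; apply: le_trans (ler_normD _ _) _.
rewrite addrC mulrDl mul1r; apply: lerD.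
  by rewrite /z normrZ gtr0_norm// mulrC ler_wpM2r ?(ltW c_gt0)// phiM// tauT.
by apply: le_trans (D_le _ tt) _; lra.
Qed.

Lemma scaling_ultimate_bound n (A a : R -> R) (F G : 'rV[R]_n -> 'rV[R]_n)
    (L B : R) :
  clock A a -> 0 < L -> 0 <= B ->
  (forall x y, `|F y - F x| <= L * `|y - x|) ->
  (forall x, c^-1 *: F (c *: x) @[c --> +oo] --> G x) ->
  globally_asymptotically_stable G 0 ->
  exists b, forall x, perturbed_solution a F B x ->
    exists T : R, forall t : R, T <= t -> `|x t| <= b.
Proof.
move=> cA L0 B0 FL FG gas; have [Ac dA Amono Ainf] := cA.
have [T [c0 [M [T0 c00 M0 win]]]] := scaling_window cA L0 B0 FL FG gas.
exists (M * c0) => x xsol; have {}win := win x xsol.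
have /choice[next nextP] : forall s : R, exists t, 0 <= s -> s <= t /\ A t = A s + T.
  move=> s; have [s0|] := leP 0 s; last by exists 0.
  by have [t] := Ainf s T s0 (ltW T0); exists t.
pose tn k := iter k next 0.
have tn0 k : 0 <= tn k.
  by elim: k => [|k IH] //=; apply: le_trans IH (nextP _ IH).1.
have tnA k : A (tn k) = A 0 + k%:R * T.
  elim: k => [|k IH]; first by rewrite mul0r addr0.
  by rewrite /= (nextP _ (tn0 k)).2 IH -addrA -natr1 mulrDl mul1r.
have halve k : `|x (tn k.+1)| <= Num.max `|x (tn k)| c0 / 2.
  by have [h1 h2] := nextP _ (tn0 k); have [] := win _ _ (tn0 k) h1 h2.
have decay k : `|x (tn k)| <= Num.max (`|x 0| / 2 ^+ k) c0.
  elim: k => [|k IH]; first by rewrite expr0 divr1 le_max lexx.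
  apply: le_trans (halve k) _; rewrite exprS invfM mulrCA mulrC.
  have [h|h] := leP `|x (tn k)| c0.
    by rewrite le_max; apply/orP; right; lra.
  move: IH; rewrite !le_max => /orP[IH|IH]; last by rewrite leNgt h in IH.
  by rewrite ler_pM2l ?invr_gt0// IH.
have [N Nc0] := exists_half_pow_lt `|x 0| c00.
have small k : (N <= k)%N -> `|x (tn k)| <= c0.
  move=> Nk; apply: le_trans (decay k) _; rewrite ge_max lexx andbT.
  apply: le_trans (ltW Nc0); rewrite ler_wpM2l// lef_pV2 ?posrE ?exprn_gt0//.
  by rewrite ler_weXn2l// ler1n.
exists (tn N) => t Nt.
have t0 : 0 <= t by exact: le_trans (tn0 N) Nt.
have Aw s u : 0 <= s -> s <= u -> A s <= A u.
  by move=> s0; rewrite le_eqVlt => /predU1P[->//|su]; rewrite ltW// Amono.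
have q0 : 0 <= (A t - A 0) / T by rewrite divr_ge0 ?subr_ge0 ?Aw// ltW.
have /andP[] := Num.Theory.truncn_itv q0.
set k := Num.truncn _.
rewrite ler_pdivlMr// ltr_pdivrMr// lerBrDl ltrBlDl -!tnA => kt tk.
have Ainv s u : 0 <= s -> 0 <= u -> A s <= A u -> s <= u.
  move=> s0 u0; rewrite leNgt => /negP As; rewrite leNgt; apply/negP => us.
  by apply: As; exact: Amono.
have Nk : (N <= k)%N.
  rewrite -ltnS -(ltr_nat R) -(ltr_pM2r T0) -(ltrD2l (A 0)) -!tnA.
  exact: le_lt_trans (Aw _ _ (tn0 N) Nt) tk.
have [h1 h2] := nextP _ (tn0 k).
have [_ /(_ t)] := win _ _ (tn0 k) h1 h2.
rewrite (Ainv _ _ (tn0 k) t0 kt) (Ainv _ _ t0 (tn0 k.+1) (ltW tk)) => /(_ isT).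
by move/le_trans; apply; rewrite ler_wpM2l// ge_max lexx andbT small.
Qed.

End ultimate_boundedness.

(** * Continuity of the sum of a Taylor series *)

Section taylor_series.
Context {R : realType}.

(** The terms of the factorization of y^k - x^k are bounded by delta times those of
    the factorization of (r + 1)^k - r^k. *)
Lemma power_dist_le (r delta x y : R) k : 0 <= r -> 0 <= delta ->
  `|x| <= r -> `|y| <= r -> `|y - x| <= delta ->
  `|y ^+ k - x ^+ k| <= delta * ((r + 1) ^+ k - r ^+ k).
Proof.
move=> r0 delta0 xr yr xy; elim: k => [|k IH].
  by rewrite !expr0 !subrr normr0 mulr0.
have -> : y ^+ k.+1 - x ^+ k.+1 = (y - x) * y ^+ k + x * (y ^+ k - x ^+ k).
  by rewrite !exprS; ring.
apply: le_trans (ler_normD _ _) _; rewrite !normrM normrX.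
have h1 : `|y| ^+ k <= r ^+ k by rewrite lerXn2r ?nnegrE.
have h2 : `|y - x| * `|y| ^+ k <= delta * r ^+ k.
  by apply: ler_pM => //; exact: exprn_ge0.
have h3 : `|x| * `|y ^+ k - x ^+ k| <= r * (delta * ((r + 1) ^+ k - r ^+ k)).
  by apply: ler_pM.
have h4 : r ^+ k <= (r + 1) ^+ k by rewrite lerXn2r ?nnegrE ?addr_ge0// lerDl.
have h5 : 0 <= delta * ((r + 1) ^+ k - r ^+ k) by rewrite mulr_ge0// subr_ge0.
rewrite !exprS; lra.
Qed.

(** Bounds of the form delta (w - v), where v bounds the factors, are stable under
    products: w1 w2 - v1 v2 = (w1 - v1) w2 + v1 (w2 - v2). *)
Lemma prod_dist_le (I : Type) (s : seq I) (p q v w : I -> R) (delta : R) :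
  0 <= delta -> (forall i, 0 <= v i <= w i) ->
  (forall i, `|p i| <= v i) -> (forall i, `|q i| <= v i) ->
  (forall i, `|q i - p i| <= delta * (w i - v i)) ->
  `|\prod_(i <- s) q i - \prod_(i <- s) p i| <=
    delta * (\prod_(i <- s) w i - \prod_(i <- s) v i).
Proof.
move=> delta0 vw pv qv qp.
have prod_le (u : I -> R) t : (forall i, `|u i| <= v i) ->
    `|\prod_(i <- t) u i| <= \prod_(i <- t) v i.
  by move=> uv; rewrite normr_prod; apply: ler_prod => i _; rewrite normr_ge0 uv.
have v_le_w t : 0 <= \prod_(i <- t) v i <= \prod_(i <- t) w i.
  rewrite prodr_ge0; last by move=> i _; case/andP: (vw i).
  by apply: ler_prod => i _; exact: vw.
elim: s => [|i s IH]; first by rewrite !big_nil !subrr normr0 mulr0.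
rewrite !big_cons.
have /andP[V0 VW] := v_le_w s; have Q := prod_le q s qv.
set P' := \prod_(j <- s) p j in IH *; set Q' := \prod_(j <- s) q j in IH Q *.
set V := \prod_(j <- s) v j in IH V0 VW Q *.
set W := \prod_(j <- s) w j in IH VW *.
have -> : q i * Q' - p i * P' = (q i - p i) * Q' + p i * (Q' - P') by ring.
apply: le_trans (ler_normD _ _) _; rewrite !normrM.
have /andP[v0 vwi] := vw i.
have h1 : `|q i - p i| * `|Q'| <= delta * (w i - v i) * W.
  by apply: ler_pM => //; exact: le_trans VW.
have h2 : `|p i| * `|Q' - P'| <= v i * (delta * (W - V)) by apply: ler_pM.
by apply: le_trans (lerD h1 h2) _; rewrite le_eqVlt; apply/orP; left; apply/eqP; ring.
Qed.

Lemma monom_dist_le K (r delta : R) (x y : 'rV[R]_K) (alpha : {ffun 'I_K -> nat}) :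
  0 <= r -> 0 <= delta -> (forall i, `|x 0 i| <= r) -> (forall i, `|y 0 i| <= r) ->
  (forall i, `|y 0 i - x 0 i| <= delta) ->
  `|monom y alpha - monom x alpha| <=
    delta * monom (const_mx (r + 1)) alpha.
Proof.
move=> r0 delta0 xr yr xy.
have rr1 k : r ^+ k <= (r + 1) ^+ k by rewrite lerXn2r ?nnegrE ?addr_ge0// lerDl.
rewrite /monom.
under [X in delta * X]eq_bigr do rewrite mxE.
apply: le_trans (prod_dist_le (v := fun i => r ^+ alpha i)
  (w := fun i => (r + 1) ^+ alpha i) _ delta0 _ _ _ _) _.
- by move=> i; rewrite exprn_ge0//= rr1.
- by move=> i; rewrite normrX lerXn2r ?nnegrE.
- by move=> i; rewrite normrX lerXn2r ?nnegrE.
- by move=> i; exact: power_dist_le.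
- by rewrite ler_wpM2l// gerBl prodr_ge0// => i _; exact: exprn_ge0.
Qed.

Lemma box_sum_le K (w : {ffun 'I_K -> nat} -> R) N :
  (forall alpha, 0 <= w alpha) ->
  ((\sum_(beta : {ffun 'I_K -> 'I_N}) w [ffun i => nat_of_ord (beta i)])%:E <=
    \esum_(alpha in setT) (w alpha)%:E)%E.
Proof.
move=> w0; pose h (beta : {ffun 'I_K -> 'I_N}) : {ffun 'I_K -> nat} :=
  [ffun i => nat_of_ord (beta i)].
apply: esum_ge; exists (h @` setT).
  split => //; apply: finite_image; exact: finite_finset.
rewrite fsbig_image; last first.
  move=> b b' _ _ /ffunP hb; apply/ffunP => i; apply: val_inj.
  by have := hb i; rewrite !ffunE.
rewrite -sumEFin.
rewrite (@fsbig_seq _ _ _ _ (index_enum {ffun 'I_K -> 'I_N}) _ (index_enum_uniq _)).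
rewrite le_eqVlt; apply/orP; left; apply/eqP; apply: eq_fsbigl.
by apply/seteqP; split => // beta _ /=; rewrite mem_index_enum.
Qed.

(** Every partial sum is Lipschitz near x, with the same constant: the sum of the
   series of absolute values at a larger radius. *)
Lemma taylor_continuous K m (G0 : 'rV[R]_K -> 'rV[R]_m)
    (c : {ffun 'I_K -> nat} -> 'rV[R]_m) :
  taylor_expansion G0 c -> continuous G0.
Proof.
move=> [cfin cG] x; pose r := `|x| + 1.
have r0 : 0 <= r by rewrite addr_ge0.
have rr0 : forall i, 0 <= (const_mx (r + 1) : 'rV[R]_K) 0 i.
  by move=> i; rewrite mxE addr_ge0.
have w0 alpha : 0 <= `|c alpha| * monom (const_mx (r + 1)) alpha.
  by rewrite mulr_ge0// prodr_ge0// => i _; rewrite exprn_ge0.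
have [S S0 SP] : exists2 S : R, 0 <= S & forall N : nat,
    \sum_(beta : {ffun 'I_K -> 'I_N})
      (fun alpha => `|c alpha| * monom (const_mx (r + 1)) alpha)
        [ffun i => nat_of_ord (beta i)] <= S.
  have := cfin _ rr0; set E := esum _ _ => Efin.
  have E0 : (0 <= E)%E by apply: esum_ge0 => alpha _; rewrite lee_fin w0.
  exists (fine E); first exact: fine_ge0.
  move=> N; rewrite -lee_fin fineK ?ge0_fin_numE//.
  exact: (@box_sum_le _ (fun alpha => `|c alpha| * monom (const_mx (r + 1)) alpha)).
have lip y : `|y - x| <= 1 -> `|G0 y - G0 x| <= `|y - x| * S.
  move=> xy.
  pose part z N : 'rV[R]_m := \sum_(beta : {ffun 'I_K -> 'I_N})
    let alpha := [ffun i => nat_of_ord (beta i)] in monom z alpha *: c alpha.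
  have nc : `|part y N - part x N| @[N --> \oo] --> `|G0 y - G0 x|.
    by apply: cvg_norm; apply: cvgB; exact: cG.
  rewrite -(cvg_lim _ nc)//; apply: limr_le; first by apply/cvg_ex; eexists; exact: nc.
  apply: nearW => N; rewrite /= /part -sumrB.
  apply: le_trans (ler_norm_sum _ _ _) _.
  apply: le_trans (ler_wpM2l (normr_ge0 _) (SP N)).
  rewrite mulr_sumr; apply: ler_sum => beta _ /=.
  rewrite -scalerBl normrZ [leLHS]mulrC [leRHS]mulrCA ler_wpM2l//.
  apply: monom_dist_le => //.
  - by move=> i; apply: le_trans (coord_norm_le _ _ _) _; rewrite lerDl.
  - move=> i; apply: le_trans (coord_norm_le _ _ _) _; rewrite /r.
    by rewrite -[y](subrK x) (le_trans (ler_normD _ _))// addrC lerD2l.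
  - move=> i; have := coord_norm_le (y - x) 0 i.
    by rewrite !mxE.
apply/(@cvgrPdist_le _ _ _ (nbhs x)) => e e0.
have M0 : 0 < S + 1 by rewrite ltr_wpDl.
near=> y.
have h1 : `|x - y| <= 1.
  by apply: ltW; near: y; exact: (@near_dist_lt _ 'rV[R]_K x 1 ltr01).
have h2 : `|x - y| < e / (S + 1).
  by near: y; exact: (@near_dist_lt _ 'rV[R]_K x _ (divr_gt0 e0 M0)).
rewrite distrC; apply: le_trans (lip y _) _; first by rewrite distrC.
move: h2; rewrite ltr_pdivlMr// distrC mulrDr mulr1 => /ltW; apply: le_trans.
by rewrite lerDl.
Unshelve. all: by end_near. Qed.

End taylor_series.

(** * Recurrence on the torus *)

Section torus.
Context {R : realType}.

Definition int_row K (k : 'I_K -> int) : 'rV[R]_K := \row_i (k i)%:~R.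

Definition zperiodic K (T : Type) (H : 'rV[R]_K -> T) : Prop :=
  forall x k, H (x + int_row k) = H x.

Lemma periodicz (f : R -> R) (T : R) (a : R) (k : int) :
  periodic f T -> f (a + T *~ k) = f a.
Proof.
move=> fT; case: k => n; first by rewrite -pmulrn periodicn.
by rewrite NegzE mulrNz -[in RHS](subrK (T *~ n.+1) a) -pmulrn periodicn.
Qed.

Lemma circ_zperiodic K : zperiodic (@circ R K).
Proof.
move=> x k; apply/rowP => i; rewrite !mxE.
have -> : 2 * pi * (x 0 i + (k i)%:~R) = 2 * pi * x 0 i + (pi *+ 2) *~ k i :> R.
  by rewrite mulrDr -[in X in _ = _ + X]mulrzr mulr_natl.
by rewrite (periodicz _ _ (@cosD2pi R)) (periodicz _ _ (@sinD2pi R)).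
Qed.

(** Uniform continuity near the compact unit ball, carried to every point by an
    integer translation. *)
Lemma zperiodic_uniformly_continuous K (H : 'rV[R]_K -> R) (e : R) :
  continuous H -> zperiodic H -> 0 < e ->
  exists2 delta : R, 0 < delta &
    forall x v, `|v| <= delta -> `|H (x + v) - H x| <= e.
Proof.
move=> Hc Hp e0.
have /compact_near_coveringP Kcov := @closed_norm_ball_compact R K 1.
have small : \forall d \near 0^'+, [set x : 'rV[R]_K | `|x| <= 1] `<=`
    (fun x => forall v : 'rV[R]_K, `|v| <= d -> `|H (x + v) - H x| <= e).
  apply: Kcov => x _.
  have e2 : 0 < e / 2 by exact: divr_gt0.
  have /cvgrPdist_le /(_ _ e2) := Hc x.
  move=> /nbhs_ballP[eta /= eta0 xeta].
  have eta2 : 0 < eta / 2 by exact: divr_gt0.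
  exists ([set y | `|x - y| < eta / 2], [set d | d < eta / 2]) => /=.
    split; first exact: (@near_dist_lt _ 'rV[R]_K x _ eta2).
    exact: nbhs_right_lt.
  move=> [y d] /= [xy deta] v vd.
  have h1 : `|H x - H (y + v)| <= e / 2.
    apply: xeta; rewrite -ball_normE/= opprD addrA (le_lt_trans (ler_normB _ _))//.
    by have := le_lt_trans vd deta; lra.
  have h2 : `|H x - H y| <= e / 2.
    by apply: xeta; rewrite -ball_normE/=; apply: lt_trans xy _; lra.
  have -> : H (y + v) - H y = - (H x - H (y + v)) + (H x - H y) by ring.
  by apply: le_trans (ler_normD _ _) _; rewrite normrN; lra.
have [d [dsmall d0]] := filter_ex (filterI small (nbhs_right_gt (0 : R))).
exists d => // x v vd.
pose k (i : 'I_K) := Num.floor (x 0 i).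
have -> : x = x - int_row k + int_row k by rewrite subrK.
rewrite addrAC !Hp; apply: dsmall => //=.
apply: mx_norm_le => // j i; rewrite (ord1 j) !mxE.
have /andP[] := Num.Theory.floor_itv (x 0 i); rewrite intrD => h1 h2.
rewrite ger0_norm; first by rewrite /k; lra.
by rewrite subr_ge0.
Qed.

(** Pigeonhole on the cells of side 1/N of the torus visited at the multiples of
    the time M1; two multiples in the same cell differ by an almost period. *)
Lemma torus_recurrence K (omega : 'rV[R]_K) (e M : R) : 0 < e ->
  exists2 T : R, M <= T & 0 < T /\
    exists k : 'I_K -> int, `|T *: omega - int_row k| <= e.
Proof.
move=> e0; pose M1 := Num.max M 1.
have M10 : 0 < M1 by rewrite lt_max ltr01 orbT.
pose N := (Num.truncn e^-1).+1.
have N0 : (0 : R) < N%:R by rewrite ltr0n.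
have Ne : (N%:R : R)^-1 <= e.
  by rewrite invf_ple// ltW// Num.Theory.truncnS_gt.
pose frac (a : R) := a - (Num.floor a)%:~R.
have frac0 a : 0 <= frac a.
  by rewrite subr_ge0; have /andP[] := Num.Theory.floor_itv a.
have frac1 a : frac a < 1.
  by have /andP[_] := Num.Theory.floor_itv a; rewrite intrD /frac; lra.
have cellN a : (Num.truncn (N%:R * frac a) < N)%N.
  rewrite -(ltr_nat R).
  apply: (@le_lt_trans _ _ (N%:R * frac a)).
    by have /andP[] := Num.Theory.truncn_itv (mulr_ge0 (ltW N0) (frac0 a)).
  by rewrite -[ltRHS]mulr1 ltr_pM2l.
pose cell (j : 'I_(N ^ K).+1) : {ffun 'I_K -> 'I_N} :=
  [ffun i => Ordinal (cellN (j%:R * M1 * omega 0 i))].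
have /injectivePn[j1 [j2 j12 cellE]] : ~~ injectiveb cell.
  apply/negP => /injectiveP /leq_card.
  by rewrite card_ffun !card_ord ltnn.
wlog lt_j : j1 j2 j12 cellE / (j1 < j2)%N.
  move=> wl; have : (j1 < j2)%N || (j2 < j1)%N by rewrite -neq_ltn.
  by case/orP; [apply: wl|apply: wl => //; rewrite eq_sym].
pose a i := j1%:R * M1 * omega 0 i; pose b i := j2%:R * M1 * omega 0 i.
have fracE i : `|frac (b i) - frac (a i)| <= e.
  apply: le_trans Ne; move/ffunP/(_ i): cellE; rewrite !ffunE => -[] /=.
  rewrite -/(a i) -/(b i) => E.
  have /andP[] := Num.Theory.truncn_itv (mulr_ge0 (ltW N0) (frac0 (a i))).
  have /andP[] := Num.Theory.truncn_itv (mulr_ge0 (ltW N0) (frac0 (b i))).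
  rewrite -E -natr1; set q := (Num.truncn _)%:R => h1 h2 h3 h4.
  rewrite -(ler_pM2l N0) mulfV ?gt_eqF// -[X in X * `|_|]gtr0_norm// -normrM.
  rewrite ler_norml; apply/andP; split; lra.
exists ((j2 - j1)%:R * M1).
  apply: (@le_trans _ _ M1); first by rewrite le_max lexx.
  by rewrite ler_peMl ?(ltW M10)// ler1n subn_gt0.
split; first by rewrite mulr_gt0// ltr0n subn_gt0.
exists (fun i => Num.floor (b i) - Num.floor (a i)).
apply: mx_norm_le; first exact: ltW.
move=> r i; rewrite (ord1 r) !mxE intrB.
have -> : (j2 - j1)%:R * M1 * omega 0 i -
    ((Num.floor (b i))%:~R - (Num.floor (a i))%:~R) = frac (b i) - frac (a i).
  by rewrite natrB 1?ltnW// /frac /a /b; ring.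
exact: fracE.
Qed.

(** An almost period T makes the orbit on [-T, 0] shadow the orbit on [0, T]. *)
Lemma backward_average K (H : 'rV[R]_K -> R) (omega phi : 'rV[R]_K)
    (U : R -> R) (c : R) : continuous H -> zperiodic H ->
  (forall t : R, is_derive t 1 U (H (phi + t *: omega))) -> U 0 = 0 ->
  T^-1 * U T @[T --> +oo] --> c ->
  forall e M : R, 0 < e ->
    exists T : R, [/\ M <= T, 0 < T & `|T^-1 * - U (- T) - c| <= e].
Proof.
move=> Hc Hp dU U0 Uc e M e0.
have e2 : 0 < e / 2 by exact: divr_gt0.
have [d d0 Hd] := zperiodic_uniformly_continuous Hc Hp e2.
move/cvgrPdist_le : Uc => /(_ _ e2) [M1 [_ near_c]].
have [T MT [T0 [k Tk]]] := torus_recurrence omega (Num.max M (M1 + 1)) d0.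
move: MT; rewrite ge_max => /andP[MT M1T].
exists T; split => //.
have Tc : `|c - T^-1 * U T| <= e / 2.
  by apply: near_c; apply: lt_le_trans M1T; rewrite ltrDl.
have shift (t : R) : is_derive t 1 (fun s => U (s - T)) (H (phi + (t - T) *: omega)).
  rewrite -[H _]scale1r; apply: (is_derive_comp1 (p := fun s => s - T) (dU _)).
  by rewrite -[X in is_derive _ _ _ X]subr0; exact: is_deriveB.
have cont (V : R -> R) (dV : R -> R) : (forall t : R, is_derive t 1 V (dV t)) ->
    {within `[0, T], continuous V}.
  by move=> dVt; apply: continuous_subspaceT => t; exact: is_derive_continuous (dVt t).
have dlin (t : R) : is_derive t 1 (fun s => e / 2 * s) (e / 2 * 1).
  exact: is_deriveZ.
have ddiff (t : R) : is_derive t 1 (fun s => U (s - T) - U s)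
    (H (phi + (t - T) *: omega) - H (phi + t *: omega)).
  exact: is_deriveB.
have := @norm_increment1_le _ (fun s => U (s - T) - U s) _ (fun s => e / 2 * s)
  (fun=> e / 2 * 1) 0 T (ltW T0) (cont _ _ ddiff) (cont _ _ dlin)
  (fun t _ => ddiff t) (fun t _ => dlin t).
rewrite subrr U0 !sub0r subr0 mulr0 subr0 => inc.
have {inc} UT : `|- U T - U (- T)| <= e / 2 * T.
  apply: inc => t _; rewrite mulr1.
  have -> : phi + t *: omega = (phi + (t - T) *: omega) + (T *: omega - int_row k)
      + int_row k.
    by rewrite addrA subrK -addrA -scalerDl subrK.
  by rewrite Hp distrC; exact: Hd.
have -> : T^-1 * - U (- T) - c = T^-1 * (- U T - U (- T)) - (c - T^-1 * U T).
  by ring.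
apply: le_trans (ler_normB _ _) _.
have : `|T^-1 * (- U T - U (- T))| <= e / 2.
  by rewrite normrM gtr0_norm ?invr_gt0// ler_pdivrMl// mulrC.
lra.
Qed.

End torus.

(** * Poisson's equation along the clock process *)

Section clock_process.
Context {R : realType}.

Lemma Gmap_circ K m (G0 : 'rV[R]_K -> 'rV[R]_m) (x : 'rV[R]_K) :
  Gmap G0 (circ x) = G0 (\row_i cos (2 * pi * x 0 i)).
Proof.
congr (G0 _); apply/rowP => i; rewrite !mxE.
set y := 2 * pi * _.
have -> : (Complex (cos y) (sin y))^-1 = Complex (cos y) (- sin y).
  by rewrite /GRing.inv /= cos2Dsin2 !divr1.
by simpc; rewrite /=; field.
Qed.

Lemma Gmap_circN K m (G0 : 'rV[R]_K -> 'rV[R]_m) (x : 'rV[R]_K) :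
  Gmap G0 (circ (- x)) = Gmap G0 (circ x).
Proof.
by rewrite !Gmap_circ; congr (G0 _); apply/rowP => i; rewrite !mxE mulrN cosN.
Qed.

Lemma Gmap_circ_continuous K m (G0 : 'rV[R]_K -> 'rV[R]_m) :
  continuous G0 -> continuous (fun x => Gmap G0 (circ x)).
Proof.
move=> G0c; have -> : (fun x => Gmap G0 (circ x)) =
    G0 \o (fun x : 'rV[R]_K => \row_i cos (2 * pi * x 0 i)).
  by apply/funext => x; rewrite /= Gmap_circ.
move=> x; apply: continuous_comp; last exact: G0c.
apply: (@cvg_mx R _ (nbhs (x : 'rV[R]_K))) => i j.
under eq_fun do rewrite mxE.
rewrite mxE; apply: continuous_cvg; first exact: continuous_cos.
apply: cvgM; first exact: cvg_cst.
exact: coord_continuous.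
Qed.

Lemma forcing_continuous d m K (f : 'rV[R]_d -> 'rV[R]_m -> 'rV[R]_d)
    (G0 : 'rV[R]_K -> 'rV[R]_m) :
  continuous (fun p : 'rV[R]_d * 'rV[R]_m => f p.1 p.2) -> continuous G0 ->
  continuous (fun p : 'rV[R]_d * 'rV[R]_K => f p.1 (Gmap G0 (circ p.2))).
Proof.
move=> fc G0c.
have pc : continuous (fun q : 'rV[R]_d * 'rV[R]_K => (q.1, Gmap G0 (circ q.2))).
  apply: continuous_pair; first exact: continuous_fst.
  exact: continuous_compT (@continuous_snd _ _) (Gmap_circ_continuous G0c).
exact: continuous_compT pc fc.
Qed.

Lemma orbit_continuous K (x omega : 'rV[R]_K) :
  continuous (fun t : R => x + t *: omega).
Proof.
move=> t; apply: cvgD; first exact: cvg_cst.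
by apply: cvgZ; [exact: cvg_id|exact: cvg_cst].
Qed.

Lemma vintegral_primitive n (u U : R -> 'rV[R]_n) (a b : R) : a <= b ->
  continuous u -> (forall t : R, is_derive t 1 U (u t)) ->
  vintegral `[a, b] u = U b - U a.
Proof.
move=> ab uc dU; apply/rowP => i; rewrite !mxE.
apply: (@Rintegral_primitive _ (fun t => u t 0 i) (fun t => U t 0 i)) => //.
- by move=> t; apply: cvg_coord; exact: uc.
- by move=> t; exact: is_derive_coord.
Qed.

(** Poisson's equation gives the derivative at positive times only, but for every
    phase: a shift of the phase moves any time to time 1. *)
Lemma poisson_derive d K (omega : 'rV[R]_K)
    (g ghat : 'rV[R]_d -> 'rV[R[i]]_K -> 'rV[R]_d) (gbar : 'rV[R]_d -> 'rV[R]_d)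
    (theta : 'rV[R]_d) :
  poisson omega g gbar ghat ->
  continuous (fun x : 'rV[R]_K => g theta (circ x)) ->
  forall (x : 'rV[R]_K) (t : R),
    is_derive t 1 (fun s => ghat theta (circ (x + s *: omega)))
      (gbar theta - g theta (circ (x + t *: omega))).
Proof.
move=> pg gc.
have pos x (t : R) : 0 < t ->
    is_derive t 1 (fun s => ghat theta (circ (x + s *: omega)))
      (gbar theta - g theta (circ (x + t *: omega))).
  move=> t0.
  pose u s := g theta (circ (x + s *: omega)) - gbar theta.
  have uc : continuous u.
    have gxc : continuous (fun s : R => g theta (circ (x + s *: omega))).
      exact: continuous_compT (@orbit_continuous _ x omega) gc.
    by move=> s; apply: cvgB; [exact: gxc|exact: cvg_cst].
  have [U dU U0] := exists_vprimitive uc.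
  apply: (@near_eq_is_derive _ _ _ (fun s => ghat theta (circ x) - U s)).
    near=> s; have s0 : 0 <= s by apply: ltW; near: s; exact: lt_nbhsr.
    have := pg theta x 0 s (lexx 0) s0.
    rewrite /Phi scale0r addr0 (vintegral_primitive s0 uc dU) U0 subr0 => ->.
    by rewrite addrAC subrr add0r.
  have -> : gbar theta - g theta (circ (x + t *: omega)) = 0 - u t.
    by rewrite sub0r opprB.
  by apply: is_deriveB.
move=> x t.
have := pos (x + (t - 1) *: omega) 1 ltr01.
have -> : x + (t - 1) *: omega + 1 *: omega = x + t *: omega.
  by rewrite -addrA -scalerDl subrK.
have e1 : 1 = t - (t - 1) by rewrite opprB addrC subrK.
rewrite [X in is_derive X]e1 => d1.
have sh : is_derive t 1 (fun s => s - (t - 1)) 1.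
  by rewrite -[X in is_derive _ _ _ X]subr0; exact: is_deriveB.
have := is_derive_comp1 (p := fun s => s - (t - 1)) d1 sh.
rewrite scale1r; congr is_derive; apply/funext => s.
by rewrite -addrA -scalerDl [t - 1 + _]addrC subrK.
Unshelve. all: by end_near. Qed.

End clock_process.

Section torus_differential.
Context {R : realType} {d K : nat}.
Implicit Types (g : 'rV[R]_d -> 'rV[R[i]]_K -> 'rV[R]_d).

Lemma is_diff_pair_cst (U V : normedModType R) (x : V) (u : U) :
  differentiable (fun v : U => (v, x)) u /\
  ('d (fun v : U => (v, x)) u : U -> U * V) = (fun v => (v, 0)).
Proof.
have [dd dE] := is_diff_pair (is_diff_id u) (is_diff_cst x u).
by split; [exact: dd|exact: dE].
Qed.

Lemma diffN_app (U V : normedModType R) (h : U -> V) (x v : U) :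
  differentiable h x -> 'd (- h) x v = - 'd h x v.
Proof. by move=> /diffN ->. Qed.

Lemma dthetaE g (theta v : 'rV[R]_d) (z : 'rV[R[i]]_K) :
  v *m dtheta g theta z = 'd (fun y => g y z) theta v.
Proof. by rewrite /dtheta /jacobian mul_rV_lin1. Qed.

Lemma dtheta_diff g (theta v : 'rV[R]_d) (x : 'rV[R]_K) : C1_torus g ->
  v *m dtheta g theta (circ x) =
  'd (fun p : 'rV[R]_d * 'rV[R]_K => g p.1 (circ p.2)) (theta, x) (v, 0).
Proof.
move=> [dg _]; rewrite dthetaE.
set h := (X in 'd X (theta, x)).
have [d1 d2] := is_diff_pair_cst x theta.
have -> : (fun y => g y (circ x)) = h \o (fun v => (v, x)) by [].
by rewrite diff_comp//= ?d2.
Qed.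

Lemma C1_torus_differentiable g (theta : 'rV[R]_d) (x : 'rV[R]_K) : C1_torus g ->
  differentiable (fun y => g y (circ x)) theta.
Proof.
move=> [dg _].
exact: (differentiable_comp (is_diff_pair_cst x theta).1 (dg (theta, x))).
Qed.

Lemma C1_torus_continuous g : C1_torus g ->
  continuous (fun p : 'rV[R]_d * 'rV[R]_K => g p.1 (circ p.2)).
Proof. by move=> [dg _] p; exact: differentiable_continuous. Qed.

(** The definition of C^1 gives continuity of the differential in each fixed
    direction; a moving direction is expanded on the canonical basis. *)
Lemma dtheta_continuous (T : topologicalType) g (p : T -> 'rV[R]_d * 'rV[R]_K)
    (v : T -> 'rV[R]_d) : C1_torus g -> continuous p -> continuous v ->
  continuous (fun s => v s *m dtheta g (p s).1 (circ (p s).2)).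
Proof.
move=> gC1 pc vc; have [_ dgc] := gC1.
have -> : (fun s => v s *m dtheta g (p s).1 (circ (p s).2)) =
    (fun s => \sum_(i < d) v s 0 i *:
      'd (fun q : 'rV[R]_d * 'rV[R]_K => g q.1 (circ q.2)) (p s) (delta_mx 0 i, 0)).
  apply/funext => s; rewrite [in LHS](row_sum_delta (v s)) mulmx_suml.
  apply: eq_bigr => i _; rewrite -scalemxAl; congr (_ *: _).
  by case: (p s) => theta x; exact: dtheta_diff.
apply: continuous_big => [|i _ s]; first exact: add_continuous.
apply: cvgZ; first by apply: cvg_coord; exact: vc.
have dc : continuous (fun s =>
    'd (fun q : 'rV[R]_d * 'rV[R]_K => g q.1 (circ q.2)) (p s) (delta_mx 0 i, 0)).
  exact: continuous_compT pc (dgc (delta_mx 0 i, 0)).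
exact: dc.
Qed.

End torus_differential.

(** * Reflection symmetry *)

Section symmetry.
Context {R : realType} {d m K : nat}.

Lemma ergodic_primitive (omega x : 'rV[R]_K) p q (g : 'rV[R[i]]_K -> 'M[R]_(p, q))
    i j (U : R -> R) :
  ergodic omega g -> continuous (fun x : 'rV[R]_K => g (circ x) i j) ->
  (forall t : R, is_derive t 1 U (g (circ (x + t *: omega)) i j)) -> U 0 = 0 ->
  T^-1 * U T @[T --> +oo] --> pi_mean g i j.
Proof.
move=> erg gc dU U0.
apply: (time_average_primitive _ dU U0 (erg x)).
exact: continuous_compT (@orbit_continuous _ _ x omega) gc.
Qed.

Lemma eq0_norm_le (y : R) : (forall e, 0 < e -> `|y| <= e) -> y = 0.
Proof.
move=> ye; apply/eqP; rewrite -normr_le0 leNgt; apply/negP => y0.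
by have := ye _ (divr_gt0 y0 (ltr0n R 2)); rewrite ler_pdivlMr//; lra.
Qed.

(** The average of an odd function over a backward orbit from 0 is the opposite of
    its average over the forward orbit, and both are close to the mean. *)
Lemma odd_ergodic_mean0 (omega : 'rV[R]_K) p q (g : 'rV[R[i]]_K -> 'M[R]_(p, q)) :
  ergodic omega g -> continuous (fun x : 'rV[R]_K => g (circ x)) ->
  (forall x, g (circ (- x)) = - g (circ x)) -> pi_mean g = 0.
Proof.
move=> erg gc godd; apply/matrixP => i j; rewrite [RHS]mxE.
pose H (x : 'rV[R]_K) : R := g (circ x) i j.
have Hc : continuous H by exact: continuous_compT gc (@coord_continuous _ _ _ i j).
have Hp : zperiodic H by move=> x k; rewrite /H circ_zperiodic.
have Hodd x : H (- x) = - H x by rewrite /H godd mxE.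
have oc : continuous (fun t : R => H (0 + t *: omega)).
  exact: continuous_compT (@orbit_continuous _ _ 0 omega) Hc.
have [U dU U0] := exists_primitive oc.
have Uc := ergodic_primitive erg Hc dU U0.
have Ueven t : U (- t) = U t.
  have dd (s : R) : is_derive s 1 (fun r => U (- r) - U r) 0.
    have dN : is_derive s 1 (fun r : R => - r) (- 1) by exact: is_deriveNid.
    have d1 := is_derive_comp1 (p := fun r => - r) (dU (- s)) dN.
    have -> : (0 : R) = - 1 *: H (0 + - s *: omega) - H (0 + s *: omega).
      by rewrite !add0r scaleN1r scaleNr Hodd opprK subrr.
    exact: is_deriveB.
  have := is_derive_0_is_cst t 0 dd.
  by rewrite oppr0 subrr => /eqP; rewrite subr_eq0 => /eqP.
set c := pi_mean g i j in Uc *.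
apply: eq0_norm_le => e e0.
have /cvgrPdist_le /(_ _ e0) [M [_ near_c]] := Uc.
have [T [MT T0 back]] := backward_average Hc Hp dU U0 Uc (M + 1) e0.
have : `|c - T^-1 * U T| <= e by apply: near_c; apply: lt_le_trans MT; rewrite ltrDl.
move: back; rewrite Ueven mulrN; set y := T^-1 * U T => h1 h2.
have -> : c = - ((- y - c) - (c - y)) / 2 by field.
rewrite normrM normrN [X in _ * X]gtr0_norm ?invr_gt0//.
by have := ler_normB (- y - c) (c - y); lra.
Qed.

(** The sum ghat (x) + ghat (- x) is constant along the flow, because g is even.
    It is also the sum of a forward time average of ghat and of a backward one,
    which are both close to the mean of ghat, zero. *)
Lemma poisson_solution_odd (omega : 'rV[R]_K)
    (g ghat : 'rV[R]_d -> 'rV[R[i]]_K -> 'rV[R]_d) (gbar : 'rV[R]_d -> 'rV[R]_d)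
    (theta : 'rV[R]_d) :
  poisson omega g gbar ghat ->
  continuous (fun x : 'rV[R]_K => g theta (circ x)) ->
  continuous (fun x : 'rV[R]_K => ghat theta (circ x)) ->
  (forall x, g theta (circ (- x)) = g theta (circ x)) ->
  ergodic omega (ghat theta) -> pi_mean (ghat theta) = 0 ->
  forall x, ghat theta (circ (- x)) = - ghat theta (circ x).
Proof.
move=> pg gc hc geven erg mean0 x.
apply/eqP; rewrite eq_sym -subr_eq0 -opprD oppr_eq0; apply/eqP/rowP => i.
rewrite !mxE.
pose H (x : 'rV[R]_K) : R := ghat theta (circ x) 0 i.
have Hc : continuous H by exact: continuous_compT hc (@coord_continuous _ _ _ 0 i).
have Hp : zperiodic H by move=> y k; rewrite /H circ_zperiodic.
have orb y : continuous (fun t : R => H (y + t *: omega)).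
  exact: continuous_compT (@orbit_continuous _ _ y omega) Hc.
have [U1 dU1 U10] := exists_primitive (orb x).
have [U2 dU2 U20] := exists_primitive (orb (- x)).
have U1c := ergodic_primitive erg Hc dU1 U10.
have U2c := ergodic_primitive erg Hc dU2 U20.
have dNid (s : R) : is_derive s 1 (fun r : R => - r) (- 1) by exact: is_deriveNid.
pose k := H x + H (- x).
have kE t : H (x + t *: omega) + H (- x + - t *: omega) = k.
  pose G (y : 'rV[R]_K) (r : R) := gbar theta - g theta (circ (y + r *: omega)).
  have dH (y : 'rV[R]_K) (r : R) :
      is_derive r 1 (fun s => H (y + s *: omega)) (G y r 0 i).
    by have := is_derive_coord i (poisson_derive pg gc y r).
  have dd (s : R) : is_derive s 1
      (fun r => H (x + r *: omega) + H (- x + - r *: omega)) 0.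
    have d2 := is_derive_comp1 (p := fun r => - r) (dH (- x) (- s)) (dNid s).
    have -> : (0 : R) = G x s 0 i + - 1 *: G (- x) (- s) 0 i.
      by rewrite scaleN1r /G scaleNr -opprD geven subrr.
    exact: is_deriveD.
  by have := is_derive_0_is_cst t 0 dd => ->; rewrite oppr0 !scale0r !addr0.
have UE t : U1 t - U2 (- t) = k * t.
  have dd (s : R) : is_derive s 1 (fun r => (U1 r - U2 (- r)) - k * r) 0.
    have d2 := is_derive_comp1 (p := fun r => - r) (dU2 (- s)) (dNid s).
    have -> : (0 : R) = (H (x + s *: omega) - - 1 *: H (- x + - s *: omega)) - k * 1.
      by rewrite scaleN1r opprK kE mulr1 subrr.
    exact: is_deriveB.
  have := is_derive_0_is_cst t 0 dd.
  by rewrite oppr0 U10 U20 subrr mulr0 subrr => /eqP; rewrite subr_eq0 => /eqP.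
rewrite -[LHS]/k; apply: eq0_norm_le => e e0.
have e2 : 0 < e / 2 by exact: divr_gt0.
move: U1c U2c; rewrite mean0 mxE => U1c U2c.
have /cvgrPdist_le /(_ _ e2) [M [_ near_c]] := U1c.
have [T [MT T0 back]] := backward_average Hc Hp dU2 U20 U2c (M + 1) e2.
have : `|0 - T^-1 * U1 T| <= e / 2.
  by apply: near_c; apply: lt_le_trans MT; rewrite ltrDl.
have -> : k = T^-1 * - U2 (- T) - 0 - (0 - T^-1 * U1 T).
  rewrite subr0 sub0r opprK -mulrDr addrC UE mulrCA mulVf ?mulr1//.
  by rewrite gt_eqF.
move=> h; apply: le_trans (ler_normB _ _) _; lra.
Qed.

Lemma Upsilon_continuous (f : 'rV[R]_d -> 'rV[R]_m -> 'rV[R]_d)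
    (G0 : 'rV[R]_K -> 'rV[R]_m) (fhat : 'rV[R]_d -> 'rV[R[i]]_K -> 'rV[R]_d)
    (theta : 'rV[R]_d) :
  continuous (fun p : 'rV[R]_d * 'rV[R]_m => f p.1 p.2) -> continuous G0 ->
  C1_torus fhat ->
  continuous (fun x : 'rV[R]_K => Upsilon f G0 fhat theta (circ x)).
Proof.
move=> fc G0c fC1; have Fc := forcing_continuous fc G0c.
have Jc := @dtheta_continuous _ _ _ _ fhat (fun y => (theta, y))
  (fun y => f theta (Gmap G0 (circ y))) fC1 (@continuous_pairr _ _ theta)
  (continuous_slice (x := theta) Fc).
have Nc : continuous (fun v : 'rV[R]_d => - v) by exact: opp_continuous.
exact: continuous_compT Jc Nc.
Qed.

Lemma Upsilon_bar_eq0 (f : 'rV[R]_d -> 'rV[R]_m -> 'rV[R]_d)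
    (G0 : 'rV[R]_K -> 'rV[R]_m) (omega : 'rV[R]_K)
    (fhat ffhat Uhat : 'rV[R]_d -> 'rV[R[i]]_K -> 'rV[R]_d) (theta : 'rV[R]_d) :
  continuous (fun p : 'rV[R]_d * 'rV[R]_m => f p.1 p.2) -> continuous G0 ->
  QSA5 f G0 omega fhat ffhat Uhat -> Upsilon_bar f G0 fhat theta = 0.
Proof.
move=> fc G0c [erg [pf mf fC1 _] _ _ _].
have Fc := forcing_continuous fc G0c.
have fodd th x : fhat th (circ (- x)) = - fhat th (circ x).
  have [[_ ergf _] _] := erg th.
  apply: (poisson_solution_odd (theta := th) pf) => //.
  - exact: (continuous_slice (x := th) Fc).
  - exact: (continuous_slice (x := th) (C1_torus_continuous fC1)).
  - by move=> y; rewrite Gmap_circN.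
have [_ [ergU _ _]] := erg theta.
apply: (odd_ergodic_mean0 ergU); first exact: Upsilon_continuous.
move=> x; rewrite /Upsilon Gmap_circN; congr (- _).
rewrite [LHS]dthetaE [X in _ = - X]dthetaE.
have -> : (fun y => fhat y (circ (- x))) = - (fun y => fhat y (circ x)).
  by apply/funext => y; rewrite fodd.
exact/diffN_app/C1_torus_differentiable.
Qed.

End symmetry.

(** * Integration against a test function *)

Section compact_support.
Context {R : realType}.
Local Notation mu := (@lebesgue_measure R).

Lemma compact_support_restrict (u : R -> R) (D : set R) (s t : R) :
  0 < s -> (forall x, ~~ (s <= x <= t) -> u x = 0) ->
  (forall x, s <= x <= t -> D x) -> u \_ D = u.
Proof.
move=> s0 u0 sD; apply/funext => x; rewrite patchE; case: ifPn => // xD.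
rewrite u0//; apply/negP => /sD Dx; move: xD; rewrite notin_setE; exact.
Qed.

Lemma compact_support_integrable (u : R -> R) (D : set R) (s t : R) :
  measurable D -> 0 < s -> continuous u ->
  (forall x, ~~ (s <= x <= t) -> u x = 0) -> mu.-integrable D (EFin \o u).
Proof.
move=> mD s0 uc u0.
apply: (@integrableS _ _ _ _ setT) => //.
have -> : EFin \o u = (EFin \o u) \_ `[s, t].
  apply/funext => x; rewrite patchE; case: ifPn => // xD /=.
  rewrite u0//; apply/negP => h; move: xD; rewrite notin_setE/= in_itv/=; exact.
apply/(integrable_mkcond _ _).1 => //.
exact: continuous_integrable.
Qed.

Lemma compact_support_Rintegral0 (U u : R -> R) (s t : R) :
  0 < s -> continuous u -> (forall x, ~~ (s <= x <= t) -> u x = 0) ->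
  (forall x, ~~ (s <= x <= t) -> U x = 0) ->
  (forall x : R, is_derive x 1 U (u x)) ->
  \int[mu]_(x in `]0, +oo[) u x = 0.
Proof.
move=> s0 uc u0 U0 dU.
pose b := Num.max s t + 1.
have b0 : 0 <= b by rewrite addr_ge0// le_max (ltW s0).
have restr (D : set R) : (forall x, s <= x <= t -> D x) ->
    \int[mu]_(x in D) u x = \int[mu]_x u x.
  by move=> sD; rewrite Rintegral_mkcond (compact_support_restrict s0 u0 sD).
rewrite restr => [|x /andP[sx _]]; last first.
  by rewrite /= in_itv/= andbT (lt_le_trans s0 sx).
rewrite -(restr `[0, b]%classic) => [|x /andP[sx xt]]; last first.
  rewrite /= in_itv/= (le_trans (ltW s0) sx)/= /b (le_trans xt)//.
  by rewrite (@le_trans _ _ (Num.max s t)) ?le_max ?lexx ?orbT ?lerDl.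
rewrite (Rintegral_primitive b0 uc dU) !U0 ?subrr//.
  by rewrite leNgt s0.
rewrite negb_and -!ltNge; apply/orP; right.
by rewrite /b ltr_pwDr// le_max lexx orbT.
Qed.

Lemma test_function_support (psi : R -> R) (s t : R) :
  (forall u, ~~ (s <= u <= t) -> psi u = 0) ->
  forall u, ~~ (s <= u <= t) -> derive1 psi u = 0.
Proof.
move=> psi0 u us; rewrite derive1E.
have [+ <-] : is_derive u 1 (fun=> 0 : R) (0 : R) by exact: is_derive_cst.
move=> _; apply: near_eq_derive.
move: us; rewrite negb_and -!ltNge => /orP[us|tu].
  near=> x; apply: psi0; rewrite negb_and -!ltNge; apply/orP; left.
  by near: x; exact: lt_nbhsl.
near=> x; apply: psi0; rewrite negb_and -!ltNge; apply/orP; right.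
by near: x; exact: lt_nbhsr.
Unshelve. all: by end_near. Qed.

End compact_support.

Section weak_formulation.
Context {R : realType}.
Local Notation mu := (@lebesgue_measure R).

Lemma is_derive_mul (g h : R -> R) (t dg dh : R) :
  is_derive t 1 g dg -> is_derive t 1 h dh ->
  is_derive t 1 (fun s => g s * h s) (dg * h t + g t * dh).
Proof.
move=> dgt dht.
have -> : dg * h t + g t * dh = g t *: dh + h t *: dg.
  by rewrite addrC [dg * _]mulrC.
exact: is_deriveM.
Qed.

Lemma test_function_derive (psi : R -> R) : test_function psi ->
  (forall t : R, is_derive t 1 psi (derive1 psi t)) /\
  (forall t : R, is_derive t 1 (derive1 psi) (derive1n 2 psi t)).
Proof.
move=> [dpsi _]; split=> t.
  by rewrite derive1E; apply: derivableP; exact: (dpsi 0%N).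
rewrite derive1nS derive1n1 derive1E; apply: derivableP.
by have := dpsi 1%N t; rewrite derive1n1.
Qed.

(** The coordinates of the trajectory enter through their derivatives only: F2, FU
    and Ff stand for Df of the three Poisson solutions ffhat, Uhat and fhat, and
    Ef and EU for the derivatives of fhat and Uhat along the flow of the clock. *)
Lemma distribution_identity (a r w2 fh U F2 FU Ff Ef EU psi : R -> R) :
  continuous a -> continuous r -> continuous w2 -> continuous fh ->
  continuous U -> continuous F2 -> continuous FU -> continuous Ff ->
  continuous Ef -> continuous EU ->
  (forall t : R, 0 < t -> is_derive t 1 a (- r t * a t)) ->
  (forall t : R, 0 < t -> is_derive t 1 w2 (a t * F2 t - fh t)) ->
  (forall t : R, 0 < t -> is_derive t 1 fh (a t * Ff t + Ef t)) ->
  (forall t : R, 0 < t -> is_derive t 1 U (a t * FU t + EU t)) ->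
  test_function psi ->
  \int[mu]_(t in `]0, +oo[) (psi t * (- Ef t + a t * (EU t - Ff t))) =
  \int[mu]_(t in `]0, +oo[) (psi t * (a t * (r t * F2 t - a t * FU t)))
  - \int[mu]_(t in `]0, +oo[)
      ((a t * derive1 psi t - r t * a t * psi t) * (U t - F2 t))
  + \int[mu]_(t in `]0, +oo[) (derive1n 2 psi t * w2 t).
Proof.
move=> ac rc w2c fhc Uc F2c FUc Ffc Efc EUc da dw2 dfh dU psiT.
have [dpsi ddpsi] := test_function_derive psiT.
have [smooth [s [t0 [s0 psi0]]]] := psiT.
have psi0' := test_function_support psi0.
have psi0'' u : ~~ (s <= u <= t0) -> derive1n 2 psi u = 0.
  by rewrite derive1nS derive1n1; exact: test_function_support.
have psic : continuous psi by move=> x; exact: is_derive_continuous (dpsi x).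
have psic' : continuous (derive1 psi).
  by move=> x; exact: is_derive_continuous (ddpsi x).
have psic'' : continuous (derive1n 2 psi).
  move=> x; apply: (@is_derive_continuous _ _ _ _ (derive1n 3 psi x)).
  rewrite [derive1n 3 psi]derive1nS derive1E; apply: derivableP; exact: smooth.
set u := fun t => psi t * (- Ef t + a t * (EU t - Ff t)).
set u0 := fun t => psi t * (a t * (r t * F2 t - a t * FU t)).
set u1 := fun t => (a t * derive1 psi t - r t * a t * psi t) * (U t - F2 t).
set u2 := fun t => derive1n 2 psi t * w2 t.
(* Moving all derivatives onto psi by hand: psi W is the right-hand side up to the
   derivative of Q. *)
pose Q t := derive1 psi t * w2 t + psi t * fh t - psi t * (a t * U t).
pose q t := u0 t - u1 t + u2 t - u t.
have uc : continuous u.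
  move=> x; apply: cvgM; first exact: psic.
  apply: cvgD; first by apply: cvgN; exact: Efc.
  apply: cvgM; first exact: ac.
  by apply: cvgB; [exact: EUc|exact: Ffc].
have u0c : continuous u0.
  move=> x; apply: cvgM; first exact: psic.
  apply: cvgM; first exact: ac.
  apply: cvgB; first by apply: cvgM; [exact: rc|exact: F2c].
  by apply: cvgM; [exact: ac|exact: FUc].
have u1c : continuous u1.
  move=> x; apply: cvgM; last by apply: cvgB; [exact: Uc|exact: F2c].
  apply: cvgB; first by apply: cvgM; [exact: ac|exact: psic'].
  apply: cvgM; last exact: psic.
  by apply: cvgM; [exact: rc|exact: ac].
have u2c : continuous u2.
  by move=> x; apply: cvgM; [exact: psic''|exact: w2c].
have qc : continuous q.
  move=> x; apply: cvgB; last exact: uc.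
  apply: cvgD; last exact: u2c.
  by apply: cvgB; [exact: u0c|exact: u1c].
have us x : ~~ (s <= x <= t0) -> u x = 0 by move=> h; rewrite /u psi0// mul0r.
have u0s x : ~~ (s <= x <= t0) -> u0 x = 0 by move=> h; rewrite /u0 psi0// mul0r.
have u1s x : ~~ (s <= x <= t0) -> u1 x = 0.
  by move=> h; rewrite /u1 psi0// psi0'// !mulr0 subrr mul0r.
have u2s x : ~~ (s <= x <= t0) -> u2 x = 0.
  by move=> h; rewrite /u2 psi0''// mul0r.
have qs x : ~~ (s <= x <= t0) -> q x = 0.
  by move=> h; rewrite /q us// u0s// u1s// u2s// !subr0 addr0.
have Qs x : ~~ (s <= x <= t0) -> Q x = 0.
  by move=> h; rewrite /Q psi0// psi0'// !mul0r subr0 addr0.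
have dQ (x : R) : is_derive x 1 Q (q x).
  have [x0|x0] := ltP 0 x.
    have d1 := is_derive_mul (ddpsi x) (dw2 x x0).
    have d2 := is_derive_mul (dpsi x) (dfh x x0).
    have d3 := is_derive_mul (dpsi x) (is_derive_mul (da x x0) (dU x x0)).
    have -> : q x = (derive1n 2 psi x * w2 x + derive1 psi x * (a x * F2 x - fh x))
      + (derive1 psi x * fh x + psi x * (a x * Ff x + Ef x))
      - (derive1 psi x * (a x * U x) +
         psi x * (- r x * a x * U x + a x * (a x * FU x + EU x))).
      by rewrite /q /u /u0 /u1 /u2; ring.
    exact: is_deriveB.
  rewrite qs; last by rewrite negb_and -!ltNge (le_lt_trans x0 s0).
  apply: (@near_eq_is_derive _ _ _ (fun=> 0)).
    near=> y; rewrite Qs// negb_and -!ltNge; apply/orP; left.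
    by near: y; apply: lt_nbhsl; exact: le_lt_trans s0.
have q0 : \int[mu]_(x in `]0, +oo[) q x = 0.
  exact: (compact_support_Rintegral0 s0 qc qs Qs dQ).
have int v : continuous v -> (forall x, ~~ (s <= x <= t0) -> v x = 0) ->
    mu.-integrable `]0, +oo[ (EFin \o v).
  by move=> vc vs; apply: (compact_support_integrable _ s0 vc vs).
have i0 := int _ u0c u0s; have i1 := int _ u1c u1s; have i2 := int _ u2c u2s.
have iu := int _ uc us.
have c01 : continuous (fun x => u0 x - u1 x).
  by move=> x; apply: cvgB; [exact: u0c|exact: u1c].
have i01 : mu.-integrable `]0, +oo[ (EFin \o (fun x => u0 x - u1 x)).
  by apply: int c01 _ => x h; rewrite u0s// u1s// subrr.
have i012 : mu.-integrable `]0, +oo[ (EFin \o (fun x => u0 x - u1 x + u2 x)).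
  apply: int => [x|x h]; first by apply: cvgD; [exact: c01|exact: u2c].
  by rewrite u0s// u1s// u2s// subrr addr0.
move: q0; rewrite /q RintegralB// RintegralD// RintegralB// => /eqP.
by rewrite subr_eq0 => /eqP.
Unshelve. all: by end_near. Qed.

End weak_formulation.

(** * The mean flow representation *)

Section mean_flow.
Context {R : realType} {d m K : nat}.
Local Notation mu := (@lebesgue_measure R).
Implicit Types (g ghat : 'rV[R]_d -> 'rV[R[i]]_K -> 'rV[R]_d).

Definition on_torus g (p : 'rV[R]_d * 'rV[R]_K) : 'rV[R]_d := g p.1 (circ p.2).

Lemma is_derive_pair (U V : normedModType R) (p : R -> U) (q : R -> V) (t : R)
    (dp : U) (dq : V) : is_derive t 1 p dp -> is_derive t 1 q dq ->
  is_derive t 1 (fun s => (p s, q s)) (dp, dq).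
Proof.
move=> [/derivable1_diffP pd pE] [/derivable1_diffP qd qE].
have pqd := differentiable_pair pd qd.
have pqv : derivable (fun s => (p s, q s)) t 1 by exact/derivable1_diffP.
split; first exact: pqv.
by rewrite deriveE// diff_pair// -!deriveE// pE qE.
Qed.

Lemma orbit_derive (omega x : 'rV[R]_K) (t : R) :
  is_derive t 1 (fun s => x + s *: omega) omega.
Proof.
apply: is_derive_row => i.
have -> : (fun s : R => (x + s *: omega) 0 i) = (fun s => x 0 i + s * omega 0 i).
  by apply/funext => s; rewrite !mxE.
have d1 : is_derive t 1 (fun s : R => s * omega 0 i) (1 * omega 0 i + t * 0).
  by apply: is_derive_mul.
have d2 : is_derive t 1 (fun s => x 0 i + s * omega 0 i)
  (0 + (1 * omega 0 i + t * 0)) by exact: is_deriveD.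
by rewrite add0r mulr0 addr0 mul1r in d2.
Qed.

(** The left-hand side is continuous in (theta, x): this is how the continuity in
    theta of a mean such as fbar, an iterated integral, is obtained. *)
Lemma flow_diff g ghat (omega : 'rV[R]_K) (gbar : 'rV[R]_d -> 'rV[R]_d)
    (theta : 'rV[R]_d) (x : 'rV[R]_K) :
  C1_torus ghat -> poisson omega g gbar ghat ->
  continuous (fun y : 'rV[R]_K => g theta (circ y)) ->
  'd (on_torus ghat) (theta, x) (0, omega) = gbar theta - g theta (circ x).
Proof.
move=> [dg _] pg gc.
have d1 := poisson_derive pg gc x 0.
have dp : is_derive (0 : R) 1 (fun s => (theta, x + s *: omega)) (0, omega).
  by apply: is_derive_pair; exact: orbit_derive.
have dg0 : differentiable (on_torus ghat) (theta, x + 0 *: omega) by exact: dg.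
have [_ d2] := is_derive_comp_diff dg0 dp.
have [_ d1E] := d1.
by rewrite scale0r addr0 in d1E d2; rewrite -d1E -d2.
Qed.

Lemma trajectory_derive (f : 'rV[R]_d -> 'rV[R]_m -> 'rV[R]_d)
    (G0 : 'rV[R]_K -> 'rV[R]_m) (omega phi : 'rV[R]_K) g (a : R)
    (Theta : R -> 'rV[R]_d) (t : R) : C1_torus g ->
  is_derive t 1 Theta (a *: f (Theta t) (Gmap G0 (Phi omega phi t))) ->
  is_derive t 1 (fun s => g (Theta s) (Phi omega phi s))
    (a *: Df f G0 g (Theta t) (Phi omega phi t) +
     'd (on_torus g) (Theta t, phi + t *: omega) (0, omega)).
Proof.
move=> gC1 dTheta; have [dg _] := gC1.
have dp := is_derive_pair dTheta (orbit_derive omega phi t).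
have dgt : differentiable (on_torus g) (Theta t, phi + t *: omega) by exact: dg.
have := is_derive_comp_diff dgt dp.
set v := f _ _.
have -> : (a *: v, omega) = a *: (v, 0) + (0, omega).
  transitivity (a *: v + 0, a *: (0 : 'rV[R]_K) + omega); last by [].
  by rewrite addr0 scaler0 add0r.
rewrite linearD linearZ/= /Df.
by rewrite (@dtheta_diff _ _ _ g (Theta t) v (phi + t *: omega) gC1).
Qed.

Lemma is_derive_sub (V : normedModType R) (g h : R -> V) (t : R) (dg dh : V) :
  is_derive t 1 g dg -> is_derive t 1 h dh ->
  is_derive t 1 (fun s => g s - h s) (dg - dh).
Proof. by move=> dgt dht; exact: is_deriveB. Qed.

Lemma is_derive_scale n (a : R -> R) (V : R -> 'rV[R]_n) (t da : R) (dV : 'rV[R]_n) :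
  is_derive t 1 a da -> is_derive t 1 V dV ->
  is_derive t 1 (fun s => a s *: V s) (da *: V t + a t *: dV).
Proof.
move=> dat dVt; apply: is_derive_row => i.
have -> : (fun s => (a s *: V s) 0 i) = (fun s => a s * V s 0 i).
  by apply/funext => s; rewrite mxE.
by rewrite !mxE; apply: is_derive_mul; last exact: is_derive_coord.
Qed.

Lemma gain_derive (a : R -> R) (rho : R) :
  (forall t : R, 0 <= t -> a t = (1 + t) `^ (- rho)) ->
  forall t : R, 0 < t -> is_derive t 1 a (- (rho / (t + 1)) * a t).
Proof.
move=> aE t t0.
apply: (@near_eq_is_derive _ R R (fun s : R => (1 + s) `^ (- rho))).
  by near=> s; rewrite aE// ltW//; near: s; exact: lt_nbhsr.
have t1 : 0 < 1 + t by rewrite addr_gt0.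
have d1 : is_derive t 1 (fun s => 1 + s) (1 : R).
  by rewrite -[X in is_derive _ _ _ X]add0r; exact: is_deriveD.
have := is_derive_comp1 (p := fun s => 1 + s) (is_derive1_powR (- rho) t1) d1.
rewrite scale1r; congr is_derive.
have -> : (1 + t) `^ (- rho - 1) = (1 + t) `^ (- rho) / (1 + t).
  rewrite powRB; first by rewrite powRr1// ltW.
  by rewrite (gt_eqF t1) implybT.
by rewrite aE ?(ltW t0)// [t + 1]addrC; field; rewrite gt_eqF.
Unshelve. all: by end_near. Qed.

Lemma gain_continuous (rho : R) :
  continuous (fun t : R => (1 + Num.max 0 t) `^ (- rho)).
Proof.
move=> t.
have t1 : 0 < 1 + Num.max 0 t by rewrite ltr_pwDl// le_max lexx.
have c1 : {for 1 + Num.max 0 t, continuous (fun y : R => y `^ (- rho))}.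
  exact: is_derive_continuous (is_derive1_powR (- rho) t1).
have c2 : {for t, continuous (fun s : R => 1 + Num.max 0 s)}.
  by apply: cvgD; [exact: cvg_cst|exact: max0_continuous].
exact: continuous_comp c2 c1.
Qed.

Lemma mean_flow_representation (omega phi : 'rV[R]_K)
    (G0 : 'rV[R]_K -> 'rV[R]_m) (f : 'rV[R]_d -> 'rV[R]_m -> 'rV[R]_d)
    (a : R -> R) (rho : R) (fhat ffhat Uhat : 'rV[R]_d -> 'rV[R[i]]_K -> 'rV[R]_d)
    (Theta : R -> 'rV[R]_d) :
  let r := fun t : R => rho / (t + 1) in
  continuous G0 ->
  continuous (fun p : 'rV[R]_d * 'rV[R]_m => f p.1 p.2) ->
  (forall t : R, 0 <= t -> a t = (1 + t) `^ (- rho)) ->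
  QSA5 f G0 omega fhat ffhat Uhat ->
  ode_solution (fun t theta => a t *: f theta (xi G0 omega phi t)) Theta ->
  exists W : R -> 'rV[R]_d,
    perturbation_sum a (Wpert f G0 omega phi a r ffhat Uhat Theta) W /\
    forall t : R, 0 < t ->
      is_derive t 1 Theta
        (a t *: (fbar f G0 (Theta t)
                 - a t *: Upsilon_bar f G0 fhat (Theta t) + W t)).
Proof.
move=> r G0c fc aE [_ [pf _ fC1 _] [ffC1 UC1 pff pU] _ _] [Thetac dTheta].
pose P t := Phi omega phi t.
pose W t := f (Theta t) (Gmap G0 (P t)) - fbar f G0 (Theta t)
  + a t *: Upsilon_bar f G0 fhat (Theta t).
have da := gain_derive aE.
have a0 (t : R) : 0 < t -> a t != 0.
  by move=> t0; rewrite aE ?(ltW t0)// gt_eqF// powR_gt0// addr_gt0.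
have dTh (t : R) : 0 < t ->
    is_derive t 1 Theta (a t *: f (Theta t) (Gmap G0 (P t))).
  by move=> t0; have := dTheta t t0; rewrite xiE.
(* The derivative of a C^1 function along the orbit of the clock process. *)
pose flow (g : 'rV[R]_d -> 'rV[R[i]]_K -> 'rV[R]_d) (Th : R -> 'rV[R]_d) (t : R) :=
  'd (on_torus g) (Th t, phi + t *: omega) (0, omega).
have Fc := forcing_continuous fc G0c.
have flow_f Th t : flow fhat Th t = fbar f G0 (Th t) - f (Th t) (Gmap G0 (P t)).
  exact: (flow_diff _ fC1 pf (continuous_slice (x := Th t) Fc)).
have flow_ff Th t : flow ffhat Th t = - fhat (Th t) (P t).
  rewrite -[RHS]sub0r.
  exact: (flow_diff _ ffC1 pff (continuous_slice (x := Th t) (C1_torus_continuous fC1))).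
have flow_U Th t : flow Uhat Th t =
    Upsilon_bar f G0 fhat (Th t) + Df f G0 fhat (Th t) (P t).
  have Upsc := Upsilon_continuous (theta := Th t) fc G0c fC1.
  by rewrite /flow (flow_diff _ UC1 pU Upsc) /Upsilon opprK.
have traj g (t : R) : C1_torus g -> 0 < t -> is_derive t 1
    (fun s => g (Theta s) (P s)) (a t *: Df f G0 g (Theta t) (P t) + flow g Theta t).
  by move=> gC1 t0; exact: trajectory_derive gC1 (dTh t t0).
have dW2 (t : R) : 0 < t -> is_derive t 1 (fun s => ffhat (Theta s) (P s))
    (a t *: Df f G0 ffhat (Theta t) (P t) - fhat (Theta t) (P t)).
  by move=> t0; rewrite -flow_ff; exact: traj.
exists W; split; last first.
  move=> t t0; have := dTh t t0; congr is_derive; congr (_ *: _).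
  rewrite /W; set u := f _ _; set v := fbar _ _ _; set w := _ *: _.
  by apply/rowP => i; rewrite !mxE; ring.
split.
- move=> psi psiT.
  pose a' (t : R) := (1 + Num.max 0 t) `^ (- rho).
  pose r' (t : R) := rho / (Num.max 0 t + 1).
  pose Th t := Theta (Num.max 0 t).
  have maxE (t : R) : 0 < t -> Num.max 0 t = t by move=> t0; rewrite max_r// ltW.
  have a'E t : 0 < t -> a' t = a t by move=> t0; rewrite /a' maxE// aE// ltW.
  have r'E t : 0 < t -> r' t = r t by move=> t0; rewrite /r' maxE.
  have ThE t : 0 < t -> Th t = Theta t by move=> t0; rewrite /Th maxE.
  have a'c : continuous a' by exact: gain_continuous.
  have r'c : continuous r'.
    move=> t; apply: cvgM; first exact: cvg_cst.
    apply: cvgV; first by rewrite gt_eqF// ltr_wpDl// le_max lexx.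
    by apply: cvgD; [exact: max0_continuous|exact: cvg_cst].
  have Thc : continuous Th by exact: continuous_max0.
  pose pt t := (Th t, phi + t *: omega).
  have ptc : continuous pt by exact: continuous_pair Thc (@orbit_continuous _ _ phi omega).
  have gc g : C1_torus g -> continuous (fun t => g (Th t) (P t)).
    by move=> gC1; exact: continuous_compT ptc (C1_torus_continuous gC1).
  have Dgc g : C1_torus g -> continuous (fun t => Df f G0 g (Th t) (P t)).
    move=> gC1; exact: (@dtheta_continuous _ _ _ _ g pt
      (fun t => f (Th t) (Gmap G0 (P t))) gC1 ptc (continuous_compT ptc Fc)).
  have flowc g : C1_torus g -> continuous (flow g Th).
    by move=> [_ gC1]; exact: continuous_compT ptc (gC1 (0, omega)).
  have cj (V : R -> 'rV[R]_d) j : continuous V -> continuous (fun t => V t 0 j).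
    by move=> Vc; exact: continuous_compT Vc (@coord_continuous _ _ _ 0 j).
  have near_pos (t : R) : 0 < t -> \forall s \near t, 0 < s by exact: lt_nbhsr.
  have dTh' (t : R) : 0 < t -> is_derive t 1 Th (a' t *: f (Th t) (Gmap G0 (P t))).
    move=> t0; rewrite a'E// ThE//.
    apply: (@near_eq_is_derive _ _ _ Theta); last exact: dTh.
    by apply: filterS (near_pos t t0) => s s0; rewrite ThE.
  have da' (t : R) : 0 < t -> is_derive t 1 a' (- r' t * a' t).
    move=> t0; rewrite r'E// a'E//.
    apply: (@near_eq_is_derive _ R R a); last exact: da.
    by apply: filterS (near_pos t t0) => s s0; rewrite a'E.
  have trajj g j (t : R) : C1_torus g -> 0 < t ->
      is_derive t 1 (fun s => g (Th s) (P s) 0 j)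
        (a' t * Df f G0 g (Th t) (P t) 0 j + flow g Th t 0 j).
    move=> gC1 t0.
    have := is_derive_coord j (trajectory_derive gC1 (dTh' t t0)).
    by rewrite !mxE.
  have [dpsi ddpsi] := test_function_derive psiT.
  apply/rowP => j.
  have dw2 (t : R) : 0 < t -> is_derive t 1 (fun s => ffhat (Th s) (P s) 0 j)
      (a' t * Df f G0 ffhat (Th t) (P t) 0 j - fhat (Th t) (P t) 0 j).
    have e : flow ffhat Th t 0 j = - fhat (Th t) (P t) 0 j by rewrite flow_ff mxE.
    by move=> t0; rewrite -e; exact: trajj.
  have id := @distribution_identity _ a' r'
    (fun t => ffhat (Th t) (P t) 0 j) (fun t => fhat (Th t) (P t) 0 j)
    (fun t => Uhat (Th t) (P t) 0 j) (fun t => Df f G0 ffhat (Th t) (P t) 0 j)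
    (fun t => Df f G0 Uhat (Th t) (P t) 0 j) (fun t => Df f G0 fhat (Th t) (P t) 0 j)
    (fun t => flow fhat Th t 0 j) (fun t => flow Uhat Th t 0 j) psi
    a'c r'c (cj _ j (gc _ ffC1)) (cj _ j (gc _ fC1)) (cj _ j (gc _ UC1))
    (cj _ j (Dgc _ ffC1)) (cj _ j (Dgc _ UC1)) (cj _ j (Dgc _ fC1))
    (cj _ j (flowc _ fC1)) (cj _ j (flowc _ UC1)) da' dw2 (fun t => trajj fhat j t fC1)
    (fun t => trajj Uhat j t UC1) psiT.
  lazy beta in id.
  rewrite mxE summxE !big_ord_recl big_ord0 /= !mxE addr0.
  have -> : \int[mu]_(t in `]0, +oo[) (psi t *: W t) 0 j =
    \int[mu]_(t in `]0, +oo[) (psi t * (- flow fhat Th t 0 j +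
      a' t * (flow Uhat Th t 0 j - Df f G0 fhat (Th t) (P t) 0 j))).
    apply: eq_Rintegral => t; rewrite inE/= in_itv/= andbT => t0.
    rewrite flow_f flow_U a'E// ThE// /W !mxE; ring.
  rewrite id expr0 mul1r expr1 mulN1r expr2 mulN1r opprK mul1r.
  rewrite addrA; congr (_ - _ + _).
  + apply: eq_Rintegral => t; rewrite inE/= in_itv/= andbT => t0.
    rewrite r'E// a'E// ThE// -/(P t).
    move: (Df _ _ ffhat _ _) (Df _ _ Uhat _ _) (a0 t t0) => D1 D2 at0.
    rewrite subn0 !mxE.
    by field.
  + apply: eq_Rintegral => t; rewrite inE/= in_itv/= andbT => t0.
    have -> : derive1 (fun s => a s ^+ (2 - bump 0 0) * psi s) t =
        - (rho / (t + 1)) * a t * psi t + a t * derive1 psi t.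
      rewrite derive1E; have [_ e] := is_derive_mul (da t t0) (dpsi t).
      exact: e.
    rewrite r'E// a'E// ThE// -/(P t) /r.
    move: (Df _ _ ffhat _ _) (Uhat _ _) => D1 U1.
    by rewrite !mxE; ring.
  + apply: eq_Rintegral => t; rewrite inE/= in_itv/= andbT => t0.
    have -> : (fun s => a s ^+ (2 - bump 0 (bump 0 0)) * psi s) = psi.
      by apply/funext => s; rewrite /= expr0 mul1r.
    rewrite ThE// -/(P t); move: (ffhat _ _) => D1.
    by rewrite !mxE.
- by move=> t t0; have [] := dW2 t t0.
- move=> t t0 dW1.
  pose W1 := Wpert f G0 omega phi a r ffhat Uhat Theta 1%N.
  have W1P : is_derive t 1 W1 (derive1 W1 t).
    by rewrite derive1E; exact: derivableP.
  have dU := traj Uhat t UC1 t0.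
  have df := traj fhat t fC1 t0.
  pose D1 := derive1 W1 t.
  have dZ : is_derive t 1
      (fun s => a s *: (Uhat (Theta s) (P s) - W1 s) - fhat (Theta s) (P s))
      ((- (rho / (t + 1)) * a t) *: (Uhat (Theta t) (P t) - W1 t)
       + a t *: (a t *: Df f G0 Uhat (Theta t) (P t) + flow Uhat Theta t - D1)
       - (a t *: Df f G0 fhat (Theta t) (P t) + flow fhat Theta t)).
    have UW1 : is_derive t 1 (fun s => Uhat (Theta s) (P s) - W1 s)
      (a t *: Df f G0 Uhat (Theta t) (P t) + flow Uhat Theta t - D1).
      exact: is_derive_sub dU W1P.
    exact: is_derive_sub (is_derive_scale (da t t0) UW1) df.
  have nZ : \forall s \near t,
      a s *: (Uhat (Theta s) (P s) - W1 s) - fhat (Theta s) (P s) =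
      derive1 (fun s => ffhat (Theta s) (P s)) s.
    near=> s; have s0 : 0 < s by near: s; exact: lt_nbhsr.
    have [_ dW2s] := dW2 s s0.
    rewrite derive1E dW2s /W1 /Wpert -/(P s); congr (_ *: _ - _).
    by rewrite opprD opprK addrCA subrr addr0.
  have d2 := near_eq_is_derive nZ dZ.
  split; first by have [] := d2.
  have [_ d2E] := d2.
  transitivity (a t ^+ 2 *: Wpert f G0 omega phi a r ffhat Uhat Theta 0%N t +
    (a t *: D1 + 1 *: derive1 (derive1 (fun s => ffhat (Theta s) (P s))) t)); last first.
    by rewrite !big_ord_recl big_ord0 addr0.
  rewrite [derive1 (derive1 _) t]derive1E d2E scale1r.
  rewrite flow_f flow_U /W /W1 /Wpert -/(P t); move: (a0 t t0) D1 {dZ d2 d2E W1P nZ}.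
  rewrite /r; move: (rho / (t + 1)) (a t) => rt at_ at0 D1.
  move: (Df _ _ ffhat _ _) (Df _ _ Uhat _ _) (Df _ _ fhat _ _) (Upsilon_bar _ _ _ _)
    (fbar _ _ _) (f _ _) (Uhat _ _) => D2 DU Df1 Ub fb f1 U1.
  by apply/rowP => j; rewrite !mxE; field.
Unshelve. all: by end_near. Qed.

End mean_flow.

(** * Ultimate boundedness of the trajectories *)

Section qsa_ultimate_bound.
Context {R : realType} {d m K : nat}.

Lemma xi_bounded (omega phi : 'rV[R]_K) (G0 : 'rV[R]_K -> 'rV[R]_m) :
  continuous G0 -> exists2 D : R, 0 <= D & forall t, `|xi G0 omega phi t| <= D.
Proof.
move=> G0c.
have gc : {within [set x : 'rV[R]_K | `|x| <= 1], continuous (fun x => `|G0 x|)}.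
  have nc : continuous (fun x : 'rV[R]_K => `|G0 x|).
    exact: continuous_compT G0c (@norm_continuous _ _).
  exact: continuous_subspaceT.
have ne : [set x : 'rV[R]_K | `|x| <= 1] !=set0 by exists 0; rewrite /= normr0 ler01.
have [c _ cmax] := EVT_max_rV ne (@closed_norm_ball_compact R K 1) gc.
exists `|G0 c| => // t; apply: cmax; rewrite inE/=.
apply: mx_norm_le => // i j; rewrite !mxE.
by rewrite ler_norml cos_geN1 cos_le1.
Qed.

Lemma orbit_forcing_continuous (omega phi : 'rV[R]_K) (G0 : 'rV[R]_K -> 'rV[R]_m)
    (f : 'rV[R]_d -> 'rV[R]_m -> 'rV[R]_d) theta :
  continuous G0 -> continuous (fun p : 'rV[R]_d * 'rV[R]_m => f p.1 p.2) ->
  continuous (fun t : R => f theta (xi G0 omega phi t)).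
Proof.
move=> G0c fc; under eq_fun do rewrite xiE.
exact: (continuous_compT (continuous_compT (@orbit_continuous _ _ phi omega)
  (@continuous_pairr _ _ theta)) (forcing_continuous fc G0c)).
Qed.

(** At two times the forcing differs by at most L (D + D), for the same theta;
    and fbar theta is a limit of averages of the forcing. *)
Lemma forcing_deviation_le (omega phi : 'rV[R]_K) (G0 : 'rV[R]_K -> 'rV[R]_m)
    (f : 'rV[R]_d -> 'rV[R]_m -> 'rV[R]_d) (L D : R) :
  continuous G0 -> continuous (fun p : 'rV[R]_d * 'rV[R]_m => f p.1 p.2) ->
  (forall theta, time_average (fun t => f theta (xi G0 omega phi t)) T
     @[T --> +oo] --> fbar f G0 theta) ->
  0 <= L -> 0 <= D ->
  (forall theta x y, `|f theta y - f theta x| <= L * `|y - x|) ->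
  (forall t, `|xi G0 omega phi t| <= D) ->
  forall theta t, `|f theta (xi G0 omega phi t) - fbar f G0 theta| <= L * (D + D).
Proof.
move=> G0c fc fm L0 D0 fL xiD theta t.
have B0 : 0 <= L * (D + D) by rewrite mulr_ge0// addr_ge0.
set v := f theta _.
have close s : `|v - f theta (xi G0 omega phi s)| <= L * (D + D).
  apply: le_trans (fL _ _ _) _; rewrite ler_wpM2l//.
  by apply: le_trans (ler_normB _ _) _; rewrite lerD.
apply: mx_norm_le => // i j; rewrite (ord1 i) {i}.
have -> : (v - fbar f G0 theta) 0 j = v 0 j - fbar f G0 theta 0 j by rewrite !mxE.
pose u (s : R) : R := f theta (xi G0 omega phi s) 0 j.
have uc : continuous u.
  have oc := @orbit_forcing_continuous omega phi G0 f theta G0c fc.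
  exact: continuous_compT oc (@coord_continuous _ _ _ 0 j).
have [U dU U0] := exists_primitive uc.
have avg := time_average_primitive uc dU U0 (fm theta).
have nc : `|v 0 j - T^-1 * U T| @[T --> +oo] --> `|v 0 j - fbar f G0 theta 0 j|.
  by apply: cvg_norm; apply: cvgB; [exact: cvg_cst|exact: avg].
rewrite -(cvg_lim _ nc)//; apply: limr_le; first by apply/cvg_ex; eexists; exact: nc.
near=> T.
have T0 : 0 < T by near: T; exact: nbhs_pinfty_gt (num_real 0).
have dlin (k s : R) : is_derive s 1 (fun r => k * r) (k * 1) by exact: is_deriveZ.
have ddiff (s : R) : is_derive s 1 (fun r => v 0 j * r - U r) (v 0 j * 1 - u s).
  have d1 := dlin (v 0 j) s; exact: is_derive_sub d1 (dU s).
have cont (V dV : R -> R) : (forall s : R, is_derive s 1 V (dV s)) ->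
    {within `[0, T], continuous V}.
  by move=> dVs; apply: continuous_subspaceT => s; exact: is_derive_continuous (dVs s).
have := @norm_increment1_le _ _ _ _ _ 0 T (ltW T0) (cont _ _ ddiff)
  (cont _ _ (dlin (L * (D + D)))) (fun s _ => ddiff s) (fun s _ => dlin _ s).
rewrite !mulr0 U0 !subr0 => inc.
have -> : v 0 j - T^-1 * U T = T^-1 * (v 0 j * T - U T) by field; rewrite gt_eqF.
rewrite normrM gtr0_norm ?invr_gt0// ler_pdivrMl// [T * _]mulrC; apply: inc => s _.
rewrite !mulr1; have := coord_norm_le (v - f theta (xi G0 omega phi s)) 0 j.
by rewrite !mxE => /le_trans; apply.
Unshelve. all: by end_near. Qed.

(** The time scale of the gain (1 + t)^(- rho) is (1 + t)^(1 - rho) / (1 - rho),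
    which is unbounded because rho < 1. *)
Lemma power_gain_clock (a : R -> R) (rho : R) : rho < 1 ->
  (forall t : R, 0 <= t -> a t = (1 + t) `^ (- rho)) ->
  clock (fun t => (1 + Num.max 0 t) `^ (1 - rho) / (1 - rho)) a.
Proof.
move=> rho1 aE; have p0 : 0 < 1 - rho by rewrite subr_gt0.
have maxE (t : R) : 0 <= t -> Num.max 0 t = t by move=> t0; rewrite max_r.
split.
- move=> t; apply: cvgM; last exact: cvg_cst.
  by have := @gain_continuous R (rho - 1) t; rewrite opprB.
- move=> t t0; split; last by rewrite aE ?powR_ge0// ltW.
  apply: (@near_eq_is_derive _ R R
    (fun s : R => (1 - rho)^-1 * (1 + s) `^ (1 - rho))).
    near=> s; rewrite maxE 1?mulrC// ltW//; near: s; exact: lt_nbhsr.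
  have t1 : 0 < 1 + t by rewrite addr_gt0.
  have d1 : is_derive t 1 (fun s => 1 + s) (1 : R).
    by rewrite -[X in is_derive _ _ _ X]add0r; exact: is_deriveD.
  have d2 := is_derive_comp1 (p := fun s => 1 + s) (is_derive1_powR (1 - rho) t1) d1.
  have d3 : is_derive t 1 (fun s : R => (1 - rho)^-1 * (1 + s) `^ (1 - rho)) 
     ((1 - rho)^-1 * (1 *: ((1 - rho) * (1 + t) `^ (1 - rho - 1)))).
    exact: is_deriveZ.
  move: d3; rewrite scale1r mulrA mulVf ?gt_eqF// mul1r.
  by rewrite addrAC subrr add0r -aE// ltW.
- move=> s t s0 st; have t0 := le_lt_trans s0 st.
  rewrite (maxE s s0) (maxE t (ltW t0)) ltr_pM2r ?invr_gt0//.
  apply: gt0_ltr_powR => //; rewrite ?nnegrE ?addr_ge0 ?(ltW t0)//.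
  by rewrite ltrD2l.
- move=> s T s0 T0; pose y := (1 + s) `^ (1 - rho) + T * (1 - rho).
  have s1 : 0 <= 1 + s by rewrite addr_ge0.
  have y0 : 0 <= y by rewrite addr_ge0 ?powR_ge0// mulr_ge0// ltW.
  have ys : 1 + s <= y `^ (1 - rho)^-1.
    have -> : 1 + s = ((1 + s) `^ (1 - rho)) `^ (1 - rho)^-1.
      by rewrite -powRrM mulfV ?gt_eqF// powRr1.
    apply: ge0_ler_powR; rewrite ?nnegrE ?powR_ge0// ?invr_ge0 ?(ltW p0)//.
    by rewrite lerDl mulr_ge0// ltW.
  exists (y `^ (1 - rho)^-1 - 1); first by rewrite lerBrDl.
  have t0 : 0 <= y `^ (1 - rho)^-1 - 1.
    by rewrite subr_ge0; apply: le_trans ys; rewrite lerDl.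
  rewrite (maxE s s0) (maxE _ t0).
  rewrite addrC subrK -powRrM mulVf ?gt_eqF// powRr1// /y mulrDl.
  by rewrite mulfK// gt_eqF.
Unshelve. all: by end_near. Qed.

(** [QSA3a] speaks of solutions of the mean flow; as these exist from every initial
    condition, the decrease of V holds at every point outside S. *)
Lemma QSA3a_lyapunov (f : 'rV[R]_d -> 'rV[R]_m -> 'rV[R]_d)
    (G0 : 'rV[R]_K -> 'rV[R]_m) (L : R) : 0 < L ->
  (forall x y, `|fbar f G0 y - fbar f G0 x| <= L * `|y - x|) ->
  QSA3a f G0 ->
  exists (V : 'rV[R]_d -> R) (LV delta r0 : R),
    [/\ 0 <= LV, 0 < delta, forall x, 0 <= V x,
        forall x y, `|V y - V x| <= LV * `|y - x| &
        forall x, r0 < `|x| ->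
          differentiable V x /\ 'd V x (fbar f G0 x) <= - delta * `|x|].
Proof.
move=> L0 FL [V [delta [S [V0 [LV VL] delta0 /compact_bounded[r [_ Sr]] Vdecr]]]].
exists V, `|LV|, delta, (r + 1); split => //.
  move=> x y; apply: le_trans (VL x y) _.
  by rewrite ler_wpM2r// ler_norm.
move=> theta rtheta.
have [x [xc x0 dx]] := picard theta L0 FL.
have sol : ode_solution (fun=> fbar f G0) x.
  by split => //; exact: continuous_subspaceT.
have nS : ~ S (x 0).
  rewrite x0 => /(Sr (r + 1)); rewrite ltrDl => /(_ ltr01) /=.
  by rewrite leNgt rtheta.
by have := Vdecr x sol 0 (lexx 0) nS; rewrite x0.
Qed.

Lemma qsa_ultimately_bounded (omega phi : 'rV[R]_K) (G0 : 'rV[R]_K -> 'rV[R]_m)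
    (f : 'rV[R]_d -> 'rV[R]_m -> 'rV[R]_d) (a : R -> R) (rho : R) :
  rho < 1 -> continuous G0 ->
  continuous (fun p : 'rV[R]_d * 'rV[R]_m => f p.1 p.2) ->
  (forall theta, time_average (fun t => f theta (xi G0 omega phi t)) T
     @[T --> +oo] --> fbar f G0 theta) ->
  (forall t : R, 0 <= t -> a t = (1 + t) `^ (- rho)) ->
  QSA2 f G0 -> QSA3 f G0 ->
  exists b : R, forall Theta : R -> 'rV[R]_d,
    ode_solution (fun t theta => a t *: f theta (xi G0 omega phi t)) Theta ->
    exists T : R, forall t : R, T <= t -> `|Theta t| <= b.
Proof.
move=> rho1 G0c fc fm aE [Lf [FbarL fL]] [_ QSA3].
pose L := Num.max Lf 1.
have L0 : 0 < L by rewrite lt_max ltr01 orbT.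
have LfL : Lf <= L by rewrite le_max lexx.
have FL x y : `|fbar f G0 y - fbar f G0 x| <= L * `|y - x|.
  by apply: le_trans (FbarL x y) _; rewrite ler_wpM2r.
have fxL theta x y : `|f theta y - f theta x| <= L * `|y - x|.
  have := fL theta theta x y; rewrite !subrr !normr0 !add0r => /le_trans; apply.
  by rewrite ler_wpM2r.
have [D D0 xiD] := xi_bounded omega phi G0c.
have dev := forcing_deviation_le G0c fc fm (ltW L0) D0 fxL xiD.
pose B := L * (D + D).
have B0 : 0 <= B by rewrite mulr_ge0 ?addr_ge0// ltW.
have cA := power_gain_clock rho1 aE.
have [b bP] : exists b : R, forall x, perturbed_solution a (fbar f G0) B x ->
    exists T : R, forall t : R, T <= t -> `|x t| <= b.
  case: QSA3 => [Q3a|[finf [flim _ gas]]].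
    have [V [LV [delta [r0 [LV0 delta0 V0 VL Vdecr]]]]] := QSA3a_lyapunov L0 FL Q3a.
    exact: (lyapunov_ultimate_bound cA (ltW L0) LV0 B0 delta0 FL V0 VL Vdecr).
  exact: (scaling_ultimate_bound cA L0 B0 FL flim gas).
exists b => Theta [Thetac dTheta].
have sol : perturbed_solution a (fbar f G0) B (fun t => Theta (Num.max 0 t)).
  split; first exact: continuous_max0.
  move=> t t0; exists (f (Theta t) (xi G0 omega phi t)); last first.
    by rewrite max_r ?(ltW t0)//; exact: dev.
  apply: (@near_eq_is_derive _ _ _ Theta); last exact: dTheta.
  near=> s; rewrite max_r// ltW//; near: s; exact: lt_nbhsr.
have [T ThetaT] := bP _ sol.
exists (Num.max 0 T) => t; rewrite ge_max => /andP[t0 Tt].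
by have := ThetaT t Tt; rewrite max_r.
Unshelve. all: by end_near. Qed.

End qsa_ultimate_bound.

Theorem theorem2p1 (R : realType) (d m K : nat)
    (d_gt0 : (0 < d)%N) (m_gt0 : (0 < m)%N) (K_gt0 : (0 < K)%N)
    (omega phi : 'rV[R]_K) (omega_inj : injective (omega 0))
    (G0 : 'rV[R]_K -> 'rV[R]_m) (G0_analytic : analytic_on_CK G0)
    (f : 'rV[R]_d -> 'rV[R]_m -> 'rV[R]_d)
    (f_cont : continuous (fun p : 'rV[R]_d * 'rV[R]_m => f p.1 p.2))
    (f_mean : forall theta : 'rV[R]_d,
       time_average (fun t => f theta (xi G0 omega phi t)) T @[T --> +oo]
         --> fbar f G0 theta)
    (a : R -> R) (rho : R) (a_QSA1 : QSA1 a) (rho_gt0 : 0 < rho) (rho_lt1 : rho < 1)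
    (aE : forall t : R, 0 <= t -> a t = (1 + t) `^ (- rho)) :
  let QSA_ODE := ode_solution (fun t theta => a t *: f theta (xi G0 omega phi t)) in
  let r := fun t : R => rho / (t + 1) in
  [/\ (forall fhat ffhat Uhat : 'rV[R]_d -> 'rV[R[i]]_K -> 'rV[R]_d,
         QSA5 f G0 omega fhat ffhat Uhat ->
         forall Theta : R -> 'rV[R]_d, QSA_ODE Theta ->
         exists W : R -> 'rV[R]_d,
           perturbation_sum a (Wpert f G0 omega phi a r ffhat Uhat Theta) W /\
           forall t : R, 0 < t ->
             is_derive t 1 Theta
               (a t *: (fbar f G0 (Theta t)
                        - a t *: Upsilon_bar f G0 fhat (Theta t) + W t))),
      (QSA0 omega G0 ->
       forall fhat ffhat Uhat : 'rV[R]_d -> 'rV[R[i]]_K -> 'rV[R]_d,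
         QSA5 f G0 omega fhat ffhat Uhat ->
         forall theta : 'rV[R]_d, Upsilon_bar f G0 fhat theta = 0) &
      (QSA2 f G0 -> QSA3 f G0 ->
       exists b : R, forall Theta : R -> 'rV[R]_d, QSA_ODE Theta ->
         (limf_esup (fun t => `|Theta t|%:E) +oo%R <= b%:E)%E)].
Proof.
move=> QSA_ODE r.
have G0c : continuous G0 by case: G0_analytic => c /taylor_continuous.
split.
- move=> fhat ffhat Uhat Q5 Theta.
  exact: mean_flow_representation G0c f_cont aE Q5.
- move=> _ fhat ffhat Uhat Q5 theta.
  exact: Upsilon_bar_eq0 f_cont G0c Q5.
- move=> Q2 Q3.
  have [b bP] := qsa_ultimately_bounded rho_lt1 G0c f_cont f_mean aE Q2 Q3.
  exists b => Theta /bP[T ThetaT].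
  apply: ereal_inf_le; exists (ereal_sup ((fun t => `|Theta t|%:E) @` [set t | T <= t])).
    by exists [set t | T <= t] => //; exact: nbhs_pinfty_ge (num_real T).
  apply: ge_ereal_sup => _ [t /= Tt <-]; rewrite lee_fin; exact: ThetaT.
Qed.
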